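(* Let $R$ be a commutative $\mathbb Q$-algebra and let $H$ be a functor from complex quasi-projective varieties to $R$-modules, covariant with respect to isomorphisms, with a compatible cross-product $\boxtimes:H(X)\times H(X')\to H(X\times X')$ that is $\mathbb Z$-linear in each variable, commutative, associative and has a unit $1_{pt}\in H(pt)$. Let $Z$ be a complex quasi-projective variety and let $\underline b=(b_1,b_2,\dots)$ be a sequence of elements $b_r\in H(Z)$, $r\ge 1$. Then the following identity holds in the $\mathbb Q$-algebra $\mathbb H^\Sigma(Z)=\bigoplus_{n\ge0}H^{\Sigma_n}(Z^n)\cdot t^n$: $$\sum_{n\ge 0}\Big(\sum_{(\sigma)\in(\Sigma_n)_*}\underline b^{(\sigma)}\Big)\cdot t^n=\exp\Big(\sum_{r\ge1}\mathfrak a_r(b_r)\cdot\frac{t^r}{r}\Big),$$ where $(\Sigma_n)_*$ denotes the set of conjugacy classes of $\Sigma_n$.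
   Context: For a finite group $G$ acting algebraically on a variety $X$, $G$ acts on $\bigoplus_{g\in G}H(X^g)$ via the isomorphisms $h:X^g\to X^{hgh^{-1}}$, and the delocalized $G$-equivariant theory is $H^G(X):=\big(\bigoplus_{g\in G}H(X^g)\big)^G$. For a subgroup $K\subset G$, induction is $\mathrm{Ind}_K^G:=\sum_{[g]\in G/K}g_*(-):H^K(X)\to H^G(X)$, the sum over $K$-cosets. For $g\in G$ with centralizer $Z_G(g)$, $\mathrm{Ind}^G_{Z_G(g)}$ is also applied to elements of $H(X^g)^{Z_G(g)}$, viewed as the direct summand of $H^{Z_G(g)}(X)$ coming from the $Z_G(g)$-stable summand $H(X^g)\subset\bigoplus_{h\in Z_G(g)}H(X^h)$. The cross-product induces $\boxtimes:H^G(X)\times H^{G'}(X')\to H^{G\times G'}(X\times X')$, using $(X\times X')^{(g,g')}=X^g\times X'^{g'}$. $\Sigma_n$ acts on $Z^n$ by permuting factors ($Z^0=pt$). $\mathbb H^\Sigma(Z):=\bigoplus_{n\ge0}H^{\Sigma_n}(Z^n)\cdot t^n$ (completed: infinite series in $t$ are allowed) is a commutative graded $\mathbb Q$-algebra with unit, with product $a\odot b:=\mathrm{Ind}^{\Sigma_{n+m}}_{\Sigma_n\times\Sigma_m}(a\boxtimes b)$ for $a\in H^{\Sigma_n}(Z^n)$, $b\in H^{\Sigma_m}(Z^m)$; the exponential is taken with respect to $\odot$. Creation operators: for an $r$-cycle $\sigma_r\in\Sigma_r$, the fixed set $(Z^r)^{\sigma_r}$ is the diagonal, identified with $Z$, and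 $Z_{\Sigma_r}(\sigma_r)=\langle\sigma_r\rangle$ acts trivially on it. $\mathfrak a_r:H(Z)\to H^{\Sigma_r}(Z^r)$ is $\mathfrak a_r(c)=\mathrm{Ind}^{\Sigma_r}_{\langle\sigma_r\rangle}(r\cdot c)$, with $r\cdot c\in H(Z)\cong H((Z^r)^{\sigma_r})^{\langle\sigma_r\rangle}$; equivalently $\mathfrak a_r(c)$ has component $r\cdot c$ at every $r$-cycle (identifying fixed sets with $Z$) and $0$ elsewhere. For $\sigma\in\Sigma_n$ of cycle type $(k_1,k_2,\dots)$ ($k_r$ cycles of length $r$, $\sum_r rk_r=n$), $(Z^n)^\sigma\cong\prod_r\big((Z^r)^{\sigma_r}\big)^{k_r}\cong\prod_rZ^{k_r}$. The element $\boxtimes_r(b_r)^{\boxtimes k_r}\in H(\prod_rZ^{k_r})\cong H((Z^n)^\sigma)$ is invariant under $Z_{\Sigma_n}(\sigma)$, and $\underline b^{(\sigma)}:=\mathrm{Ind}^{\Sigma_n}_{Z_{\Sigma_n}(\sigma)}\big(\boxtimes_r(b_r)^{\boxtimes k_r}\big)\in H^{\Sigma_n}(Z^n)$; it depends only on the conjugacy class $(\sigma)$. *)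

(* Defs.v *)
From HB Require Import structures.
From mathcomp Require Import all_boot all_order all_algebra all_fingroup.
From mathcomp Require Import mpoly complex boolp reals ring zify.

Set Implicit Arguments.
Unset Strict Implicit.
Unset Printing Implicit Defensive.

Import Order.TTheory GRing.Theory Num.Theory.
Local Open Scope ring_scope.

(* Classical quasi-projective varieties over an algebraically closed field k, *)
(* as sets of closed points (not necessarily irreducible). The homogeneous    *)
(* coordinates of a projective space are indexed by an arbitrary finite type  *)
(* I, so that I * J indexes the coordinates of the Segre embedding of         *)
(* P(k^I) x P(k^J).                                                           *)

Section Forms.
Variable k : closedFieldType.
Implicit Types I J : finType.

Definition is_form I (d : nat) (F : {ffun I -> k} -> k) : Prop :=
  exists2 p : {mpoly k[#|I|]}, p \is d.-homog &
    forall v, F v = p.@[fun j => v (enum_val j)].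

Definition nonzero I (v : {ffun I -> k}) : Prop := exists i, v i != 0.

Definition proj_eq I (v w : {ffun I -> k}) : Prop :=
  exists2 c : k, c != 0 & forall i, v i = c * w i.

Definition locally_closed I (A : {ffun I -> k} -> Prop) : Prop :=
  exists S T : ({ffun I -> k} -> k) -> Prop,
  [/\ forall F, S F -> exists d, is_form d F,
      forall F, T F -> exists d, is_form d F &
      forall v, nonzero v ->
        A v <-> (forall F, S F -> F v = 0) /\ (exists2 F, T F & F v != 0)].

Lemma is_form_coord I (i : I) : is_form 1 (fun v : {ffun I -> k} => v i).
Proof.
exists 'X_(enum_rank i); first by rewrite dhomogX /= mdeg1.
by move=> v; rewrite mevalXU enum_rankK.
Qed.

Lemma is_form_const I (c : k) : is_form 0 (fun _ : {ffun I -> k} => c).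
Proof.
exists (c%:MP); last by move=> v; rewrite mevalC.
by rewrite -alg_mpolyC dhomogZ // dhomog1.
Qed.

Lemma is_formM I d e (F G : {ffun I -> k} -> k) :
  is_form d F -> is_form e G -> is_form (d + e) (fun v => F v * G v).
Proof.
move=> [p hp Fp] [q hq Gq]; exists (p * q); first exact: dhomogM.
by move=> v; rewrite mevalM Fp Gq.
Qed.

Lemma is_formB I d (F G : {ffun I -> k} -> k) :
  is_form d F -> is_form d G -> is_form d (fun v => F v - G v).
Proof.
move=> [p hp Fp] [q hq Gq]; exists (p - q); first by rewrite rpredB.
by move=> v; rewrite mevalB Fp Gq.
Qed.

Lemma is_form_ext I d (F G : {ffun I -> k} -> k) :
  F =1 G -> is_form d F -> is_form d G.
Proof. by move=> FG [p hp Fp]; exists p => // v; rewrite -FG. Qed.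

Lemma is_form_prod I (T : Type) (s : seq T) (d : T -> nat)
    (F : T -> {ffun I -> k} -> k) :
  (forall t, is_form (d t) (F t)) ->
  is_form (\sum_(t <- s) d t) (fun v => \prod_(t <- s) F t v).
Proof.
move=> hF; elim: s => [|t s IHs].
  rewrite big_nil; apply: is_form_ext (is_form_const _ 1) => v.
  by rewrite big_nil.
rewrite big_cons; apply: is_form_ext (is_formM (hF t) IHs) => v.
by rewrite big_cons.
Qed.

Lemma is_form_comp I J d e (G : {ffun J -> k} -> k)
    (F : J -> {ffun I -> k} -> k) :
  is_form e G -> (forall j, is_form d (F j)) ->
  is_form (d * e) (fun v => G [ffun j => F j v]).
Proof.
move=> [q hq Gq] /fin_all_exists2 [p hp Fp].
exists (q \mPo [tuple p (enum_val j) | j < #|J|]); last first.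
  move=> v; rewrite Gq comp_mpoly_meval; apply: meval_eq => j.
  by rewrite tnth_mktuple ffunE Fp.
rewrite comp_mpolyEX; apply: rpred_sum => m _.
case: (eqVneq q@_m 0) => [->|qm]; first by rewrite scale0r rpred0.
have := dhomog_mf hq (x := m).
rewrite mcoeff_msupp qm => /(_ isT) /= <-.
apply: dhomogZ; rewrite comp_mpolyX mdegE big_distrr /=.
elim/big_rec2: _ => [|j x y _ hy]; first exact: dhomog1.
by apply: dhomogM => //; rewrite tnth_mktuple; apply: dhomogMn.
Qed.

Lemma is_form_scale I d (F : {ffun I -> k} -> k)
    (v w : {ffun I -> k}) (c : k) :
  is_form d F -> (forall i, v i = c * w i) -> F v = c ^+ d * F w.
Proof.
move=> [p hp Fp] vw; rewrite !Fp !mevalE big_distrr /=.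
apply: eq_big_seq => m /(dhomog_mf hp) /= <-.
rewrite mulrCA; congr (_ * _); rewrite mdegE -prodrXr -big_split /=.
by apply: eq_bigr => j _; rewrite vw exprMn.
Qed.

Lemma is_form_proj_eq0 I d (F : {ffun I -> k} -> k)
    (v w : {ffun I -> k}) :
  is_form d F -> proj_eq v w -> (F v == 0) = (F w == 0).
Proof.
move=> hF [c c0 /(is_form_scale hF) ->].
by rewrite mulf_eq0 expf_eq0 (negbTE c0) andbF.
Qed.

Lemma proj_eq_refl I (v : {ffun I -> k}) : proj_eq v v.
Proof. by exists 1; [exact: oner_neq0 | move=> i; rewrite mul1r]. Qed.

Lemma proj_eq_sym I (v w : {ffun I -> k}) : proj_eq v w -> proj_eq w v.
Proof.
move=> [c c0 vw]; exists c^-1; first by rewrite invr_eq0.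
by move=> i; rewrite vw mulKf.
Qed.

Lemma proj_eq_trans I (u v w : {ffun I -> k}) :
  proj_eq u v -> proj_eq v w -> proj_eq u w.
Proof.
move=> [c c0 uv] [d d0 vw]; exists (c * d); first by rewrite mulf_neq0.
by move=> i; rewrite uv vw mulrA.
Qed.

Definition segre I J (v : {ffun I -> k}) (w : {ffun J -> k}) :
    {ffun I * J -> k} := [ffun ij => v ij.1 * w ij.2].

Lemma segre_proj_eq I J (v v' : {ffun I -> k}) (w w' : {ffun J -> k}) :
  proj_eq v v' -> proj_eq w w' -> proj_eq (segre v w) (segre v' w').
Proof.
move=> [c c0 vv] [d d0 ww]; exists (c * d); first by rewrite mulf_neq0.
by move=> ij; rewrite !ffunE vv ww mulrACA.
Qed.

Lemma segre_inj I J (v v' : {ffun I -> k}) (w w' : {ffun J -> k}) :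
  nonzero v -> nonzero w -> proj_eq (segre v w) (segre v' w') ->
  proj_eq v v' /\ proj_eq w w'.
Proof.
move=> [i vi] [j wj] [c c0 E].
have E' a b : v a * w b = c * (v' a * w' b).
  by have := E (a, b); rewrite !ffunE.
have := E' i j => Eij.
have : c * (v' i * w' j) != 0 by rewrite -Eij mulf_neq0.
rewrite !mulf_eq0 !negb_or => /and3P[_ v'i w'j]; split.
  exists (c * w' j / w j); first by rewrite !mulf_neq0 ?invr_eq0.
  by move=> a; apply: (mulIf wj); rewrite E'; field.
exists (c * v' i / v i); first by rewrite !mulf_neq0 ?invr_eq0.
by move=> b; apply: (mulfI vi); rewrite E'; field.
Qed.

Lemma locally_closed_segre I J (X Y : Type) (x_ : X -> {ffun I -> k})
    (y_ : Y -> {ffun J -> k}) :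
  locally_closed (fun v => exists x, proj_eq (x_ x) v) ->
  locally_closed (fun w => exists y, proj_eq (y_ y) w) ->
  locally_closed (fun u => exists x y, proj_eq (segre (x_ x) (y_ y)) u).
Proof.
move=> [S [T [hS hT ST]]] [S' [T' [hS' hT' ST']]].
pose col (j : J) (u : {ffun I * J -> k}) : {ffun I -> k} := [ffun i => u (i, j)].
pose row (i : I) (u : {ffun I * J -> k}) : {ffun J -> k} := [ffun j => u (i, j)].
have col_form j d F : is_form d F -> is_form d (F \o col j).
  move=> hF; rewrite -[d]mul1n.
  by apply: (is_form_comp (F := fun i u => u (i, j))) => // i;
     apply: is_form_coord.
have row_form i d F : is_form d F -> is_form d (F \o row i).
  move=> hF; rewrite -[d]mul1n.
  by apply: (is_form_comp (F := fun j u => u (i, j))) => // j;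
     apply: is_form_coord.
exists (fun F => [\/ exists a b i j, F = fun u : {ffun I * J -> k} =>
                        u (a, b) * u (i, j) - u (a, j) * u (i, b),
                     exists2 G, S G & exists j, F = G \o col j
                   | exists2 G, S' G & exists i, F = G \o row i]).
exists (fun F => exists G G', [/\ T G, T' G' &
           exists i j, F = fun u => (G \o col j) u * (G' \o row i) u]).
split.
- move=> F [[a [b [i [j ->]]]]|[G /hS[d hG] [j ->]]|[G /hS'[d hG] [i ->]]].
  + by exists 2; apply: is_formB; apply: (is_formM (d := 1) (e := 1));
       apply: is_form_coord.
  + by exists d; apply: col_form.
  + by exists d; apply: row_form.
- move=> F [G [G' [/hT[d hG] /hT'[d' hG'] [i [j ->]]]]].
  by exists (d + d')%N; apply: is_formM; [apply: col_form|apply: row_form].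
move=> u [[i0 j0] u0].
have colE v w j : proj_eq (segre v w) u ->
    exists c, (forall i, col j u i = c * v i) /\ (w j != 0 -> c != 0).
  move=> [c c0 E]; exists (c^-1 * w j); split.
    by move=> i; rewrite ffunE; apply: (mulfI c0); rewrite -E ffunE /=
       mulrA mulVKf // mulrC.
  by move=> wj; rewrite mulf_neq0 ?invr_eq0.
have rowE v w i : proj_eq (segre v w) u ->
    exists c, (forall j, row i u j = c * w j) /\ (v i != 0 -> c != 0).
  move=> [c c0 E]; exists (c^-1 * v i); split.
    by move=> j; rewrite ffunE; apply: (mulfI c0); rewrite -E ffunE /=
       mulrA mulVKf.
  by move=> vi; rewrite mulf_neq0 ?invr_eq0.
split.
- move=> [x [y E]].
  have [c c0 Ec] := E.
  have E0 : x_ x i0 * y_ y j0 = c * u (i0, j0) by rewrite -Ec ffunE.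
  have : x_ x i0 * y_ y j0 != 0 by rewrite E0 mulf_neq0.
  rewrite mulf_eq0 negb_or => /andP[xi yj].
  have xn : nonzero (x_ x) by exists i0.
  have yn : nonzero (y_ y) by exists j0.
  have [Sx [F TF Fx]] : _ /\ _ := (ST _ xn).1 (ex_intro _ x (proj_eq_refl _)).
  have [Sy [F' TF' Fy]] : _ /\ _ := (ST' _ yn).1 (ex_intro _ y (proj_eq_refl _)).
  split.
  + move=> G [[a [b [i [j ->]]]]|[G' SG [j ->]]|[G' SG [i ->]]] /=.
    * have U p q : u (p, q) = c^-1 * (x_ x p * y_ y q).
        have [c' c'0 E'] := E.
        case: E => d d0 E.
        suff cd : c = d by subst; have := E (p, q); rewrite ffunE /= => ->; rewrite mulKf.
        apply: (mulIf u0); rewrite -E0.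
        by have := E (i0, j0); rewrite ffunE.
      rewrite !U; apply/eqP; rewrite subr_eq0; apply/eqP.
      rewrite mulrACA [RHS]mulrACA; congr (_ * _).
      by rewrite [LHS]mulrACA [RHS]mulrACA (mulrC (y_ y b)).
    * have [d hd] := hS _ SG; have [e [he _]] := colE _ _ j E.
      by rewrite (is_form_scale hd he) Sx // mulr0.
    * have [d hd] := hS' _ SG; have [e [he _]] := rowE _ _ i E.
      by rewrite (is_form_scale hd he) Sy // mulr0.
  + exists (fun u => (F \o col j0) u * (F' \o row i0) u).
      by exists F, F'; split => //; exists i0, j0.
    have [d hd] := hT _ TF; have [e [he /(_ yj) e0]] := colE _ _ j0 E.
    have [d' hd'] := hT' _ TF'; have [e' [he' /(_ xi) e'0]] := rowE _ _ i0 E.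
    rewrite /= (is_form_scale hd he) (is_form_scale hd' he').
    by rewrite !mulf_neq0 ?expf_neq0.
- move=> [SS [F [G [G' [TG TG' [i [j ->]]]]]]].
  rewrite /= mulf_eq0 negb_or => /andP[Gu Gu'].
  have rk a b a' b' : u (a, b) * u (a', b') = u (a, b') * u (a', b).
    apply/eqP; rewrite -subr_eq0; apply/eqP.
    by apply: (SS (fun u : {ffun I * J -> k} =>
         u (a, b) * u (a', b') - u (a, b') * u (a', b)));
       apply: Or31; exists a, b, a', b'.
  have c0n : nonzero (col j0 u) by exists i0; rewrite ffunE.
  have r0n : nonzero (row i0 u) by exists j0; rewrite ffunE.
  have [x hx] : exists x, proj_eq (x_ x) (col j0 u).
    apply/ST => //; split.
      by move=> F' SF'; apply: (SS (F' \o col j0)); apply: Or32; exists F' => //; exists j0.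
    exists G => //; have [d hd] := hT _ TG.
    have cc a : col j u a = u (i0, j) / u (i0, j0) * col j0 u a.
      by rewrite !ffunE mulrAC -rk mulrC mulKf ?mulfK //; rewrite mulrC.
    move: Gu; rewrite (is_form_scale hd cc) mulf_eq0 negb_or.
    by case/andP.
  have [y hy] : exists y, proj_eq (y_ y) (row i0 u).
    apply/ST' => //; split.
      by move=> F' SF'; apply: (SS (F' \o row i0)); apply: Or33; exists F' => //; exists i0.
    exists G' => //; have [d hd] := hT' _ TG'.
    have cc b : row i u b = u (i, j0) / u (i0, j0) * row i0 u b.
      by rewrite !ffunE mulrAC -rk mulfK.
    move: Gu'; rewrite (is_form_scale hd cc) mulf_eq0 negb_or.
    by case/andP.
  exists x, y; apply: proj_eq_trans (segre_proj_eq hx hy) _.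
  exists (u (i0, j0)) => // -[a b]; rewrite !ffunE /=.
  by rewrite rk mulrC.
Qed.

End Forms.

(* The points of a variety are given with a choice of representatives coord x *)
(* of their homogeneous coordinates; x |-> [coord x] is a bijection onto a    *)
(* locally closed subset of P(k^hidx).                                        *)
Record qpvar (k : closedFieldType) := QPVar {
  carrier :> Type;
  hidx : finType;
  coord : carrier -> {ffun hidx -> k};
  _ : forall x, nonzero (coord x);
  _ : forall x y, proj_eq (coord x) (coord y) -> x = y;
  _ : locally_closed (fun v => exists x, proj_eq (coord x) v)
}.
Arguments QPVar {k carrier hidx coord}.

Section Varieties.
Variable k : closedFieldType.
Implicit Types X Y Z : qpvar k.

Lemma coord_nonzero X (x : X) : nonzero (coord x). Proof. by case: X x. Qed.
Lemma coord_inj X (x y : X) : proj_eq (coord x) (coord y) -> x = y.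
Proof. by case: X x y. Qed.
Lemma coord_closed X : locally_closed (fun v => exists x : X, proj_eq (coord x) v).
Proof. by case: X. Qed.

(* A map is regular if, on a neighbourhood of every point, it is given by     *)
(* forms of the same degree without common zero there; the neighbourhoods     *)
(* g != 0, with g a form, are a basis of the Zariski topology.                *)
Definition regular X Y (f : X -> Y) : Prop :=
  forall x0, exists d e F g,
  [/\ forall j : hidx Y, is_form d (F j), is_form e g, g (coord x0) != 0 &
      forall x, g (coord x) != 0 ->
        proj_eq (coord (f x)) [ffun j => F j (coord x)]].

Definition zariski_closed X (P : X -> Prop) : Prop :=
  exists2 S : ({ffun hidx X -> k} -> k) -> Prop,
    forall F, S F -> exists d, is_form d F &
    forall x, P x <-> forall F, S F -> F (coord x) = 0.

Lemma regular_ext X Y (f g : X -> Y) : f =1 g -> regular f -> regular g.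
Proof. by move=> /funext ->. Qed.

Lemma regular_id X : regular (fun x : X => x).
Proof.
move=> x0; exists 1%N, 0%N, (fun j v => v j), (fun=> 1); split.
- by move=> j; apply: is_form_coord.
- exact: is_form_const.
- exact: oner_neq0.
- by move=> x _; exists 1; [exact: oner_neq0 | move=> i; rewrite ffunE mul1r].
Qed.

Lemma regular_comp X Y Z (g : Y -> Z) (f : X -> Y) :
  regular f -> regular g -> regular (fun x => g (f x)).
Proof.
move=> hf hg x0.
have [d [e [F [u [hF hu ux fE]]]]] := hf x0.
have [d' [e' [G [w [hG hw wx gE]]]]] := hg (f x0).
exists (d * d')%N, (e + d * e')%N,
  (fun j v => G j [ffun i => F i v]),
  (fun v => u v * w [ffun i => F i v]); split.
- by move=> j; apply: is_form_comp.
- by apply: is_formM => //; apply: is_form_comp.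
- by rewrite mulf_neq0 // -(is_form_proj_eq0 hw (fE _ ux)).
- move=> x; rewrite mulf_eq0 negb_or => /andP[uz wz].
  have fz := fE _ uz; rewrite -(is_form_proj_eq0 hw fz) in wz.
  apply: proj_eq_trans (gE _ wz) _; case: fz => c c0 E.
  exists (c ^+ d'); first by rewrite expf_neq0.
  by move=> j; rewrite !ffunE (is_form_scale (hG j) E).
Qed.

Lemma ptv_subproof :
  [/\ forall x : unit, nonzero ([ffun=> 1] : {ffun unit -> k}),
      forall x y : unit, proj_eq ([ffun=> 1] : {ffun unit -> k}) [ffun=> 1] ->
        x = y &
      locally_closed (fun v : {ffun unit -> k} =>
        exists x : unit, proj_eq [ffun=> 1] v)].
Proof.
split=> [_|[] []//|]; first by exists tt; rewrite ffunE oner_neq0.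
exists (fun _ => False), (fun F => F = fun v : {ffun unit -> k} => v tt); split=> //.
  by move=> F ->; exists 1%N; apply: is_form_coord.
move=> v [[] v0]; split=> [_|_]; first by split=> //; exists (fun v : {ffun unit -> k} => v tt).
exists tt, (v tt)^-1; first by rewrite invr_eq0.
by case; rewrite ffunE mulVf.
Qed.

Definition ptv : qpvar k :=
  let s := ptv_subproof in
  @QPVar k unit unit (fun=> [ffun=> 1])
    (let: And3 nz _ _ := s in nz) (let: And3 _ inj _ := s in inj)
    (let: And3 _ _ lc := s in lc).

Lemma prodv_subproof X Y :
  [/\ forall xy : X * Y, nonzero (segre (coord xy.1) (coord xy.2)),
      forall xy xy' : X * Y,
        proj_eq (segre (coord xy.1) (coord xy.2))
                (segre (coord xy'.1) (coord xy'.2)) -> xy = xy' &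
      locally_closed (fun v => exists xy : X * Y,
        proj_eq (segre (coord xy.1) (coord xy.2)) v)].
Proof.
split.
- move=> [x y]; have [i xi] := coord_nonzero x; have [j yj] := coord_nonzero y.
  by exists (i, j); rewrite ffunE mulf_neq0.
- move=> [x y] [x' y'] /segre_inj[]; try exact: coord_nonzero.
  by move=> /coord_inj/= -> /coord_inj/= ->.
- have [S [T [hS hT ST]]] := locally_closed_segre (@coord_closed X) (@coord_closed Y).
  exists S, T; split=> // v /ST <-; split=> [[[x y] h]|[x [y h]]].
    by exists x, y.
  by exists (x, y).
Qed.

Definition prodv X Y : qpvar k :=
  let s := prodv_subproof X Y in
  @QPVar k (X * Y)%type (hidx X * hidx Y)%type
    (fun xy => segre (coord xy.1) (coord xy.2))
    (let: And3 nz _ _ := s in nz) (let: And3 _ inj _ := s in inj)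
    (let: And3 _ _ lc := s in lc).

(* The n-fold power, in the n-fold Segre embedding. *)
Definition pow_coord Z n (z : 'I_n -> Z) : {ffun {ffun 'I_n -> hidx Z} -> k} :=
  [ffun f : {ffun 'I_n -> hidx Z} => \prod_(i < n) coord (z i) (f i)].

Definition upd (I : Type) n (f : {ffun 'I_n -> I}) (i : 'I_n) (a : I) :
  {ffun 'I_n -> I} := [ffun j => if j == i then a else f j].

Lemma pow_coord_upd Z n (z : 'I_n -> Z) f i a :
  pow_coord z (upd f i a) =
  (\prod_(j < n | j != i) coord (z j) (f j)) * coord (z i) a.
Proof.
rewrite ffunE (bigD1 i) //= ffunE eqxx mulrC; congr (_ * _).
by apply: eq_bigr => j ji; rewrite ffunE (negbTE ji).
Qed.

Lemma pow_coord_nonzero Z n (z : 'I_n -> Z) :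
  exists f : {ffun 'I_n -> hidx Z}, forall i, coord (z i) (f i) != 0.
Proof.
have /fin_all_exists[f hf] : forall i, exists a, coord (z i) a != 0.
  by move=> i; apply: coord_nonzero.
by exists [ffun i => f i] => i; rewrite ffunE.
Qed.

Lemma locally_closed_reindex (I J : finType) (e : I -> J)
    (A : {ffun I -> k} -> Prop) : bijective e ->
  locally_closed A -> locally_closed (fun v => A [ffun i => v (e i)]).
Proof.
move=> [e' eK e'K] [S [T [hS hT ST]]].
exists (fun F => exists2 G, S G & F = fun v : {ffun J -> k} => G [ffun i => v (e i)]).
exists (fun F => exists2 G, T G & F = fun v : {ffun J -> k} => G [ffun i => v (e i)]).
have hc d G : is_form d G ->
    is_form (1 * d) (fun v : {ffun J -> k} => G [ffun i => v (e i)]).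
  by move=> hG; apply: (is_form_comp (F := fun i v => v (e i))) => // i;
     apply: is_form_coord.
split.
- by move=> F [G /hS[d hG] ->]; exists (1 * d)%N; apply: hc.
- by move=> F [G /hT[d hG] ->]; exists (1 * d)%N; apply: hc.
move=> v [j vj]; rewrite ST; last by exists (e' j); rewrite ffunE e'K.
split=> [[hs [F TF F0]]|[hs [F [G TG ->] F0]]].
  split; first by move=> F' [G SG ->]; apply: hs.
  by exists (fun v : {ffun J -> k} => F [ffun i => v (e i)]) => //; exists F.
split; last by exists G.
by move=> G' SG'; apply: (hs (fun v : {ffun J -> k} => G' [ffun i => v (e i)])); exists G'.
Qed.

Lemma powv_subproof Z n :
  [/\ forall z : 'I_n -> Z, nonzero (pow_coord z),
      forall z z' : 'I_n -> Z, proj_eq (pow_coord z) (pow_coord z') -> z = z' &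
      locally_closed (fun v => exists z : 'I_n -> Z, proj_eq (pow_coord z) v)].
Proof.
split.
- move=> z; have [f hf] := pow_coord_nonzero z; exists f.
  by rewrite ffunE; apply/prodf_neq0 => i _.
- move=> z z' [c c0 E]; apply/funext => i; apply: coord_inj.
  have [f hf] := pow_coord_nonzero z.
  set A := \prod_(j < n | j != i) coord (z j) (f j).
  set B := \prod_(j < n | j != i) coord (z' j) (f j).
  have AB a : A * coord (z i) a = c * (B * coord (z' i) a).
    by rewrite -!pow_coord_upd E.
  have A0 : A != 0 by apply/prodf_neq0 => j _.
  have B0 : B != 0.
    have : A * coord (z i) (f i) != 0 by rewrite mulf_neq0.
    by rewrite AB !mulf_eq0 !negb_or => /and3P[].
  exists (c * B / A); first by rewrite !mulf_neq0 ?invr_eq0.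
  by move=> a; apply: (mulfI A0); rewrite AB; field.
elim: n => [|n IHn].
  pose f0 : {ffun 'I_0 -> hidx Z} := ffun0 (card_ord 0).
  have f0E f : f = f0 by apply/ffunP; case.
  exists (fun _ => False),
    (fun F => F = fun v : {ffun {ffun 'I_0 -> hidx Z} -> k} => v f0).
  split=> //; first by move=> F ->; exists 1%N; apply: is_form_coord.
  move=> v [f vf]; rewrite (f0E f) in vf; split=> [_|_].
    by split=> //; exists (fun v : {ffun {ffun 'I_0 -> hidx Z} -> k} => v f0).
  have z : 'I_0 -> Z by case.
  exists z, (v f0)^-1; first by rewrite invr_eq0.
  by move=> g; rewrite (f0E g) mulVf // ffunE big_ord0.
pose e (af : hidx Z * {ffun 'I_n -> hidx Z}) : {ffun 'I_n.+1 -> hidx Z} :=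
  [ffun i => if unlift ord0 i is Some j then af.2 j else af.1].
have e_bij : bijective e.
  exists (fun f : {ffun 'I_n.+1 -> hidx Z} => (f ord0, [ffun j => f (lift ord0 j)])).
    move=> [a f]; rewrite /e ffunE unlift_none; congr (_, _).
    by apply/ffunP => j; rewrite !ffunE liftK.
  by move=> f; apply/ffunP => i; rewrite ffunE; case: unliftP => [j|] -> //=;
     rewrite ffunE.
have eE (z : 'I_n.+1 -> Z) af : pow_coord z (e af) =
    segre (coord (z ord0)) (pow_coord (fun j => z (lift ord0 j))) af.
  rewrite !ffunE big_ord_recl ffunE unlift_none; congr (_ * _).
  by apply: eq_bigr => j _; rewrite ffunE liftK.
have := locally_closed_reindex e_bij (locally_closed_segre (@coord_closed Z) IHn).
move=> [S [T [hS hT ST]]]; exists S, T; split=> // v /ST <-.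
split=> [[z [c c0 E]]|[x [z [c c0 E]]]].
  exists (z ord0), (fun j => z (lift ord0 j)), c => // af.
  by rewrite -eE E ffunE.
exists (fun i => if unlift ord0 i is Some j then z j else x), c => // f.
have [e' _ e'K] := e_bij; rewrite -(e'K f) eE.
rewrite unlift_none; have -> : (fun j => if unlift ord0 (lift ord0 j) is Some j
  then z j else x) = z by apply/funext => j; rewrite liftK.
by rewrite E ffunE.
Qed.

Definition powv Z n : qpvar k :=
  let s := powv_subproof Z n in
  @QPVar k ('I_n -> Z) {ffun 'I_n -> hidx Z} (@pow_coord Z n)
    (let: And3 nz _ _ := s in nz) (let: And3 _ inj _ := s in inj)
    (let: And3 _ _ lc := s in lc).

Lemma subv_subproof X (P : X -> Prop) : zariski_closed P ->
  [/\ forall x : {x : X | P x}, nonzero (coord (sval x)),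
      forall x y : {x : X | P x},
        proj_eq (coord (sval x)) (coord (sval y)) -> x = y &
      locally_closed (fun v => exists x : {x : X | P x},
        proj_eq (coord (sval x)) v)].
Proof.
move=> [S hS SP]; split.
- by move=> x; apply: coord_nonzero.
- by move=> [x Px] [y Py] /coord_inj/= xy; apply: eq_exist.
have [S' [T [hS' hT ST]]] := @coord_closed X.
exists (fun F => S F \/ S' F), T; split=> //.
  by move=> F [/hS|/hS'].
move=> v vn; split=> [[[x Px] /= xv]|[hv hT']].
  have [h1 h2] := (ST v vn).1 (ex_intro _ x xv); split=> // F [SF|/h1 //].
  have [d hd] := hS _ SF; apply/eqP.
  by rewrite -(is_form_proj_eq0 hd xv); apply/eqP; apply: (SP x).1.
have [x xv] : exists x : X, proj_eq (coord x) v.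
  by apply/ST => //; split=> // F SF; apply: hv; right.
have Px : P x.
  apply/SP => F SF; have [d hd] := hS _ SF; apply/eqP.
  by rewrite (is_form_proj_eq0 hd xv); apply/eqP; apply: hv; left.
by exists (exist _ x Px).
Qed.

Definition subv X (P : X -> Prop) (hP : zariski_closed P) : qpvar k :=
  let s := subv_subproof hP in
  @QPVar k {x : X | P x} (hidx X) (fun x => coord (sval x))
    (let: And3 nz _ _ := s in nz) (let: And3 _ inj _ := s in inj)
    (let: And3 _ _ lc := s in lc).

Lemma regular_pair X Y Z (f : X -> Y) (g : X -> Z) :
  regular f -> regular g ->
  regular (fun x => (f x, g x) : prodv Y Z).
Proof.
move=> hf hg x0.
have [d [e [F [u [hF hu ux fE]]]]] := hf x0.
have [d' [e' [G [w [hG hw wx gE]]]]] := hg x0.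
exists (d + d')%N, (e + e')%N,
  (fun (ij : hidx Y * hidx Z) v => F ij.1 v * G ij.2 v), (fun v => u v * w v).
split.
- by move=> ij; apply: is_formM.
- exact: is_formM.
- by rewrite mulf_neq0.
move=> x; rewrite mulf_eq0 negb_or => /andP[ux' wx'].
have [c c0 E] := fE _ ux'; have [c' c'0 E'] := gE _ wx'.
exists (c * c'); first by rewrite mulf_neq0.
by move=> ij; rewrite !ffunE E E' !ffunE mulrACA.
Qed.

Lemma regular_fst X Y : regular (fun xy : prodv X Y => xy.1).
Proof.
move=> [x0 y0]; have [j yj] := coord_nonzero y0; have [i xi] := coord_nonzero x0.
exists 1%N, 1%N, (fun a v => v (a, j)), (fun v => v (i, j)); split.
- by move=> a; apply: is_form_coord.
- exact: is_form_coord.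
- by rewrite ffunE mulf_neq0.
move=> [x y]; rewrite ffunE /= mulf_eq0 negb_or => /andP[_ y'j].
exists (coord y j)^-1; first by rewrite invr_eq0.
by move=> a; rewrite !ffunE /= mulrC mulfK.
Qed.

Lemma regular_snd X Y : regular (fun xy : prodv X Y => xy.2).
Proof.
move=> [x0 y0]; have [j yj] := coord_nonzero y0; have [i xi] := coord_nonzero x0.
exists 1%N, 1%N, (fun a v => v (i, a)), (fun v => v (i, j)); split.
- by move=> a; apply: is_form_coord.
- exact: is_form_coord.
- by rewrite ffunE mulf_neq0.
move=> [x y]; rewrite ffunE /= mulf_eq0 negb_or => /andP[x'i _].
exists (coord x i)^-1; first by rewrite invr_eq0.
by move=> a; rewrite !ffunE /= mulKf.
Qed.

Lemma regular_tuple X Z n (f : 'I_n -> X -> Z) :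
  (forall i, regular (f i)) -> regular (fun x => (fun i => f i x) : powv Z n).
Proof.
move=> hf x0.
have /fin_all_exists[d] := fun i => hf i x0.
move=> /fin_all_exists[e] /fin_all_exists[F] /fin_all_exists[g] h.
exists (\sum_(i < n) d i)%N, (\sum_(i < n) e i)%N,
  (fun (a : {ffun 'I_n -> hidx Z}) v => \prod_(i < n) F i (a i) v),
  (fun v => \prod_(i < n) g i v); split.
- by move=> a; apply: is_form_prod => i; case: (h i).
- by apply: is_form_prod => i; case: (h i).
- by apply/prodf_neq0 => i _; case: (h i).
move=> x /prodf_neq0 gx.
have /fin_all_exists2[c c0 E] : forall i, exists2 c, c != 0 &
    forall j, coord (f i x) j = c * F i j (coord x).
  move=> i; case: (h i) => _ _ _ /(_ x (gx i isT))[c c0 E].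
  by exists c => // j; rewrite E ffunE.
exists (\prod_(i < n) c i); first by apply/prodf_neq0 => i _.
move=> a; rewrite !ffunE -big_split /=; apply: eq_bigr => i _.
by rewrite E.
Qed.

Lemma regular_proj Z n (i : 'I_n) : regular (fun z : powv Z n => z i).
Proof.
move=> z0; have [f hf] := pow_coord_nonzero z0.
exists 1%N, 1%N, (fun a v => v (upd f i a)), (fun v => v f); split.
- by move=> a; apply: is_form_coord.
- exact: is_form_coord.
- by rewrite ffunE; apply/prodf_neq0 => j _.
move=> z; rewrite ffunE => /prodf_neq0 zf.
set A := \prod_(j < n | j != i) coord (z j) (f j).
have A0 : A != 0 by apply/prodf_neq0 => j _; apply: zf.
exists A^-1; first by rewrite invr_eq0.
by move=> a; rewrite ffunE [X in _ * X](pow_coord_upd z f i a) mulKf.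
Qed.

Lemma regular_cst X Y (y : Y) : regular (fun _ : X => y).
Proof.
move=> x0; exists 0%N, 0%N, (fun j _ => coord y j), (fun=> 1); split.
- by move=> j; apply: is_form_const.
- exact: is_form_const.
- exact: oner_neq0.
by move=> x _; exists 1; [exact: oner_neq0 | move=> i; rewrite ffunE mul1r].
Qed.

Lemma regular_val X (P : X -> Prop) (hP : zariski_closed P) :
  regular (fun x : subv hP => sval x).
Proof. by move=> [x0 Px0]; have := @regular_id (subv hP) (exist _ x0 Px0). Qed.

Lemma regular_sub X Y (P : Y -> Prop) (hP : zariski_closed P)
    (f : X -> subv hP) : regular (fun x => sval (f x)) -> regular f.
Proof. by []. Qed.

Lemma zariski_closed_fixed X (f : X -> X) : regular f ->
  zariski_closed (fun x => f x = x).
Proof.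
move=> hf.
exists (fun G => exists x0 d e F g a b,
  [/\ forall j, is_form d (F j), is_form e g, g (coord x0) != 0,
      forall x, g (coord x) != 0 ->
        proj_eq (coord (f x)) [ffun j => F j (coord x)] &
      G = fun v => g v * (F a v * v b - F b v * v a)]).
  move=> G [x0 [d [e [F [g [a [b [hF hg _ _ ->]]]]]]]].
  exists (e + (d + 1))%N; apply: is_formM => //.
  by apply: is_formB; apply: is_formM => //; apply: is_form_coord.
move=> x; split=> [fx G [x0 [d [e [F [g [a [b [hF hg _ E ->]]]]]]]]|hG].
  have [->|gx] := eqVneq (g (coord x)) 0; first by rewrite mul0r.
  have [c c0] := E _ gx; rewrite fx => E'.
  have Ea := E' a; have Eb := E' b; rewrite !ffunE in Ea Eb.
  by rewrite Ea Eb; ring.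
have [d [e [F [g [hF hg gx E]]]]] := hf x.
apply: coord_inj; apply: proj_eq_trans (E _ gx) _.
have [i xi] := coord_nonzero x.
have R a b : F a (coord x) * coord x b = F b (coord x) * coord x a.
  suff /eqP : g (coord x) * (F a (coord x) * coord x b
      - F b (coord x) * coord x a) = 0.
    by rewrite mulf_eq0 (negbTE gx) subr_eq0 => /eqP.
  by apply: (hG (fun v => g v * (F a v * v b - F b v * v a)));
     exists x, d, e, F, g, a, b.
have [c c0 Ec] := E _ gx.
have Fi : exists j, F j (coord x) != 0.
  have [j fj] := coord_nonzero (f x); exists j.
  by move: fj; rewrite Ec ffunE mulf_eq0 negb_or => /andP[].
have Fi0 : F i (coord x) != 0.
  have [j Fj] := Fi; apply/eqP => Fi0.
  have := R i j; rewrite Fi0 mul0r => /esym/eqP.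
  by rewrite mulf_eq0 (negbTE Fj) (negbTE xi).
exists (F i (coord x) / coord x i); first by rewrite mulf_neq0 ?invr_eq0.
by move=> a; rewrite ffunE; apply: (mulIf xi); rewrite -R; field.
Qed.

End Varieties.

Section Isomorphisms.
Variable k : closedFieldType.
Implicit Types X Y Z W : qpvar k.

Definition is_qpiso X Y (f : X -> Y) : Prop :=
  regular f /\ exists g, [/\ cancel f g, cancel g f & regular g].

Record qpiso X Y := QPIso { iso_fun :> X -> Y; iso_prf : is_qpiso iso_fun }.

Lemma qpiso_ext X Y (f g : qpiso X Y) : (forall x, f x = g x) -> f = g.
Proof.
case: f g => [f hf] [g hg] /= /funext fg; rewrite fg in hf *.
by rewrite (Prop_irrelevance hf hg).
Qed.

Definition mk_iso X Y (f : X -> Y) (g : Y -> X) (fK : cancel f g)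
    (gK : cancel g f) (rf : regular f) (rg : regular g) : qpiso X Y :=
  QPIso (conj rf (ex_intro _ g (And3 fK gK rg))).

Definition iso_id X : qpiso X X :=
  mk_iso (fun=> erefl) (fun=> erefl) (@regular_id k X) (@regular_id k X).

Lemma iso_comp_subproof X Y Z (g : qpiso Y Z) (f : qpiso X Y) :
  is_qpiso (fun x => g (f x)).
Proof.
case: f g => [f [rf [f' [fK f'K rf']]]] [g [rg [g' [gK g'K rg']]]] /=.
split; first exact: regular_comp.
exists (fun z => f' (g' z)); split=> [x|z|]; rewrite ?gK ?f'K //.
exact: regular_comp.
Qed.
Definition iso_comp X Y Z (g : qpiso Y Z) (f : qpiso X Y) : qpiso X Z :=
  QPIso (iso_comp_subproof g f).

Lemma iso_prod_subproof X Y X' Y' (f : qpiso X X') (g : qpiso Y Y') :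
  is_qpiso (fun xy : prodv X Y => (f xy.1, g xy.2) : prodv X' Y').
Proof.
case: f g => [f [rf [f' [fK f'K rf']]]] [g [rg [g' [gK g'K rg']]]] /=; split.
  by apply: regular_pair; apply: regular_comp => //;
     [apply: regular_fst | apply: regular_snd].
exists (fun xy : prodv X' Y' => (f' xy.1, g' xy.2)); split=> [[x y]|[x y]|] /=.
- by rewrite fK gK.
- by rewrite f'K g'K.
- by apply: regular_pair; apply: regular_comp => //;
     [apply: regular_fst | apply: regular_snd].
Qed.
Definition iso_prod X Y X' Y' (f : qpiso X X') (g : qpiso Y Y') :
  qpiso (prodv X Y) (prodv X' Y') := QPIso (iso_prod_subproof f g).

Lemma regular_swap X Y :
  regular (fun xy : prodv X Y => (xy.2, xy.1) : prodv Y X).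
Proof. by apply: regular_pair; [apply: regular_snd | apply: regular_fst]. Qed.
Definition iso_swap X Y : qpiso (prodv X Y) (prodv Y X) :=
  @mk_iso (prodv X Y) (prodv Y X) (fun xy => (xy.2, xy.1))
    (fun yx => (yx.2, yx.1)) (fun '(x, y) => erefl) (fun '(y, x) => erefl)
    (@regular_swap X Y) (@regular_swap Y X).

Lemma iso_assoc_subproof X Y Z :
  is_qpiso (fun t : prodv (prodv X Y) Z =>
    (t.1.1, (t.1.2, t.2)) : prodv X (prodv Y Z)).
Proof.
have r1 X1 Y1 := @regular_fst k X1 Y1; have r2 X1 Y1 := @regular_snd k X1 Y1.
split.
  apply: regular_pair.
    exact: (regular_comp (r1 (prodv X Y) Z) (r1 X Y)).
  by apply: regular_pair => //; exact: (regular_comp (r1 (prodv X Y) Z) (r2 X Y)).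
exists (fun t : prodv X (prodv Y Z) => ((t.1, t.2.1), t.2.2)).
split=> [[[x y] z]|[x [y z]]|] //=.
apply: regular_pair.
  by apply: regular_pair => //; exact: (regular_comp (r2 X (prodv Y Z)) (r1 Y Z)).
exact: (regular_comp (r2 X (prodv Y Z)) (r2 Y Z)).
Qed.
Definition iso_assoc X Y Z :
  qpiso (prodv (prodv X Y) Z) (prodv X (prodv Y Z)) :=
  QPIso (iso_assoc_subproof X Y Z).

Lemma iso_unitl_subproof X : is_qpiso (fun tx : prodv (ptv k) X => tx.2).
Proof.
split; first exact: regular_snd.
exists (fun x => (tt, x)); split=> [[[] x]|x|] //.
by apply: regular_pair; [exact: (@regular_cst k X (ptv k) tt) | exact: regular_id].
Qed.
Definition iso_unitl X : qpiso (prodv (ptv k) X) X :=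
  QPIso (iso_unitl_subproof X).

Lemma iso_unitr_subproof X : is_qpiso (fun xt : prodv X (ptv k) => xt.1).
Proof.
split; first exact: regular_fst.
exists (fun x => (x, tt)); split=> [[x []]|x|] //.
by apply: regular_pair; [exact: regular_id | exact: (@regular_cst k X (ptv k) tt)].
Qed.
Definition iso_unitr X : qpiso (prodv X (ptv k)) X :=
  QPIso (iso_unitr_subproof X).

Definition ord0_rect (T : Type) (i : 'I_0) : T :=
  let: Ordinal m lt_m0 := i in False_rect T (notF lt_m0).

Lemma iso_pow0_subproof Z :
  is_qpiso (fun _ : ptv k => @ord0_rect Z : powv Z 0).
Proof.
split; first exact: (@regular_cst k (ptv k) (powv Z 0) _).
exists (fun=> tt); split=> [[]|z|] //; first by apply/funext; case.
exact: (@regular_cst k (powv Z 0) (ptv k) tt).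
Qed.
Definition iso_pow0 Z : qpiso (ptv k) (powv Z 0) := QPIso (iso_pow0_subproof Z).

(* Insertion of a coordinate at position i; i = 0 is the recursive            *)
(* identification of Z x Z^n with Z^(n+1).                                    *)
Definition insert_fun Z n (i : 'I_n.+1) (xz : prodv Z (powv Z n)) :
    powv Z n.+1 :=
  fun j => if unlift i j is Some j' then xz.2 j' else xz.1.

Lemma iso_insert_subproof Z n (i : 'I_n.+1) : is_qpiso (@insert_fun Z n i).
Proof.
split.
  apply: regular_tuple => j; case: (unlift i j) => [j'|]; last exact: regular_fst.
  exact: (regular_comp (@regular_snd k Z (powv Z n)) (regular_proj j')).
exists (fun z : powv Z n.+1 => (z i, fun j => z (lift i j))).
split=> [[x z]|z|].
- rewrite /insert_fun unlift_none; congr (_, _).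
  by apply/funext => j; rewrite liftK.
- by apply/funext => j; rewrite /insert_fun; case: unliftP => [j'|] ->.
apply: regular_pair; first exact: regular_proj.
by apply: regular_tuple => j; apply: regular_proj.
Qed.
Definition iso_insert Z n (i : 'I_n.+1) :
  qpiso (prodv Z (powv Z n)) (powv Z n.+1) := QPIso (iso_insert_subproof Z i).

Lemma iso_cat_subproof Z m n :
  is_qpiso (fun zz : prodv (powv Z m) (powv Z n) =>
    (fun i => match split i with inl a => zz.1 a | inr b => zz.2 b end)
    : powv Z (m + n)).
Proof.
split.
  apply: regular_tuple => i; case: (split i) => a.
    exact: (regular_comp (@regular_fst k (powv Z m) (powv Z n)) (regular_proj a)).
  exact: (regular_comp (@regular_snd k (powv Z m) (powv Z n)) (regular_proj a)).
exists (fun z : powv Z (m + n) =>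
          (fun a => z (lshift n a), fun b => z (rshift m b))).
split=> [[z z']|z|].
- congr (_, _); apply/funext => a.
    by rewrite -[lshift n a]/(unsplit (inl a)) unsplitK.
  by rewrite -[rshift m a]/(unsplit (inr a)) unsplitK.
- by apply/funext => i; case: split_ordP => a ->.
by apply: regular_pair; apply: regular_tuple => a; apply: regular_proj.
Qed.
Definition iso_cat Z m n :
  qpiso (prodv (powv Z m) (powv Z n)) (powv Z (m + n)) :=
  QPIso (iso_cat_subproof Z m n).

Lemma iso_reindex_subproof Z n (s : 'S_n) :
  is_qpiso (fun z : powv Z n => (fun i => z (s i)) : powv Z n).
Proof.
split; first by apply: regular_tuple => i; apply: regular_proj.
exists (fun z : powv Z n => (fun i => z ((s^-1)%g i))); split=> [z|z|].
- by apply/funext => i; rewrite permKV.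
- by apply/funext => i; rewrite permK.
- by apply: regular_tuple => i; apply: regular_proj.
Qed.
Definition iso_reindex Z n (s : 'S_n) : qpiso (powv Z n) (powv Z n) :=
  QPIso (iso_reindex_subproof Z s).

Lemma iso_restrict_subproof X Y (P : X -> Prop) (Q : Y -> Prop)
    (hP : zariski_closed P) (hQ : zariski_closed Q) (f : qpiso X Y)
    (PQ : forall x, P x <-> Q (f x)) :
  is_qpiso (fun x : subv hP =>
    exist Q (f (sval x)) ((PQ (sval x)).1 (svalP x)) : subv hQ).
Proof.
have [rf [g [fK gK rg]]] := iso_prf f; split.
  by apply: regular_sub; apply: regular_comp => //; apply: regular_val.
have hg (y : subv hQ) : P (g (sval y)).
  by apply/PQ; rewrite gK; exact: (svalP y).
exists (fun y : subv hQ => exist P (g (sval y)) (hg y) : subv hP).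
split=> [[x Px]|[y Qy]|].
- by apply: eq_exist => /=; rewrite fK.
- by apply: eq_exist => /=; rewrite gK.
by apply: regular_sub; apply: regular_comp => //; apply: regular_val.
Qed.
Definition iso_restrict X Y (P : X -> Prop) (Q : Y -> Prop)
    (hP : zariski_closed P) (hQ : zariski_closed Q) (f : qpiso X Y)
    (PQ : forall x, P x <-> Q (f x)) : qpiso (subv hP) (subv hQ) :=
  QPIso (iso_restrict_subproof hP hQ PQ).

End Isomorphisms.

(* The cross-product is only assumed to be biadditive, not R-bilinear.        *)
Record cross_theory (k : closedFieldType) (R : comAlgType rat) := CrossTheory {
  hmod :> qpvar k -> lmodType R;
  push : forall X Y, qpiso X Y -> {linear hmod X -> hmod Y};
  cross : forall X Y, hmod X -> hmod Y -> hmod (prodv X Y);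
  cross_one : hmod (ptv k);
  push_id : forall X (a : hmod X), push (iso_id X) a = a;
  push_comp : forall X Y Z (g : qpiso Y Z) (f : qpiso X Y) (a : hmod X),
    push (iso_comp g f) a = push g (push f a);
  crossDl : forall X Y (a a' : hmod X) (b : hmod Y),
    cross (a + a') b = cross a b + cross a' b;
  crossDr : forall X Y (a : hmod X) (b b' : hmod Y),
    cross a (b + b') = cross a b + cross a b';
  cross_push : forall X Y X' Y' (f : qpiso X X') (g : qpiso Y Y')
      (a : hmod X) (b : hmod Y),
    cross (push f a) (push g b) = push (iso_prod f g) (cross a b);
  crossC : forall X Y (a : hmod X) (b : hmod Y),
    push (iso_swap X Y) (cross a b) = cross b a;
  crossA : forall X Y Z (a : hmod X) (b : hmod Y) (c : hmod Z),
    push (iso_assoc X Y Z) (cross (cross a b) c) = cross a (cross b c);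
  cross1l : forall X (a : hmod X), push (iso_unitl X) (cross cross_one a) = a;
  cross1r : forall X (a : hmod X), push (iso_unitr X) (cross a cross_one) = a
}.
Arguments push {k R} _ {X Y} _.
Arguments cross {k R} _ {X Y} _ _.

Section IteratedCross.
Variables (k : closedFieldType) (R : comAlgType rat) (H : cross_theory k R).
Implicit Types X Y Z : qpvar k.

Lemma push_ext X Y (f g : qpiso X Y) (a : H X) :
  (forall x, f x = g x) -> push H f a = push H g a.
Proof. by move=> /qpiso_ext ->. Qed.

Lemma cross0l X Y (b : H Y) : cross H (0 : H X) b = 0.
Proof. by apply: (addrI (cross H 0 b)); rewrite -crossDl !addr0. Qed.

Lemma cross0r X Y (a : H X) : cross H a (0 : H Y) = 0.
Proof. by apply: (addrI (cross H a 0)); rewrite -crossDr !addr0. Qed.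

(* The cross-product of c_0, ..., c_(n-1), in H(Z^n). *)
Fixpoint bigcross Z n : ('I_n -> H Z) -> H (powv Z n) :=
  match n with
  | 0 => fun=> push H (iso_pow0 Z) (cross_one H)
  | n'.+1 => fun c => push H (iso_insert Z ord0)
      (cross H (c ord0) (bigcross (fun j => c (lift ord0 j))))
  end.

Lemma bigcrossS Z n (c : 'I_n.+1 -> H Z) :
  bigcross c = push H (iso_insert Z ord0)
    (cross H (c ord0) (bigcross (fun j => c (lift ord0 j)))).
Proof. by []. Qed.

Lemma bigcross_insert Z n (c : 'I_n.+1 -> H Z) (i : 'I_n.+1) :
  bigcross c = push H (iso_insert Z i)
                 (cross H (c i) (bigcross (fun j => c (lift i j)))).
Proof.
elim: n c i => [|n IHn] c i; first by rewrite (ord1 i).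
case: (unliftP ord0 i) => [j|] ->; last by [].
rewrite [LHS]bigcrossS (IHn (fun m => c (lift ord0 m)) j).
rewrite [X in _ = push H _ (cross H _ X)]bigcrossS.
have -> : lift (lift ord0 j) ord0 = ord0 :> 'I_n.+2 by apply: val_inj.
have -> : (fun m => c (lift (lift ord0 j) (lift ord0 m))) =
          (fun m => c (lift ord0 (lift j m))).
  by apply/funext => m; congr c; apply: val_inj; rewrite /= /bump /=; lia.
set a := c ord0; set b := c _; set B := bigcross _.
rewrite -[in LHS](@push_id _ _ H _ a) -[in RHS](@push_id _ _ H _ b).
rewrite !cross_push -!crossA -(crossC b a) -{1}(@push_id _ _ H _ B).
rewrite cross_push -!push_comp; apply: push_ext => -[[y x] z] /=.
apply/funext => m; rewrite /insert_fun.
case: (unliftP ord0 m) => [m'|] -> /=.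
  case: (unliftP j m') => [m''|] -> /=.
    have -> : lift ord0 (lift j m'') = lift (lift ord0 j) (lift ord0 m'').
      by apply: val_inj; rewrite /= /bump /=; lia.
    by rewrite liftK /= liftK.
  by rewrite unlift_none.
have -> : ord0 = lift (lift ord0 j) ord0 :> 'I_n.+2 by apply: val_inj.
by rewrite liftK unlift_none.
Qed.

Lemma bigcross_reindex Z n (c : 'I_n -> H Z) (s : 'S_n) :
  bigcross (fun i => c (s i)) = push H (iso_reindex Z s) (bigcross c).
Proof.
elim: n c s => [|n IHn] c s.
  rewrite -push_comp; apply: push_ext => x /=.
  by apply/funext; case.
have hs j : {j' | s (lift ord0 j) = lift (s ord0) j'}.
  case: (unliftP (s ord0) (s (lift ord0 j))) => [j'|]; first by exists j'.
  by move/perm_inj => E; have := neq_lift ord0 j; rewrite E eqxx.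
have s'_inj : injective (fun j => sval (hs j)).
  move=> j1 j2 E; apply: (@lift_inj _ ord0); apply: (@perm_inj _ s).
  by rewrite (svalP (hs j1)) (svalP (hs j2)) E.
pose s' := perm s'_inj.
have sE j : s (lift ord0 j) = lift (s ord0) (s' j).
  by rewrite permE; exact: (svalP (hs j)).
rewrite (bigcross_insert c (s ord0)) [LHS]bigcrossS.
have -> : (fun j => c (s (lift ord0 j))) = (fun j => c (lift (s ord0) (s' j))).
  by apply/funext => j; rewrite sE.
rewrite (IHn (fun j => c (lift (s ord0) j))).
rewrite -[in LHS](@push_id _ _ H _ (c (s ord0))) cross_push -!push_comp.
apply: push_ext => -[x z] /=; apply/funext => i; rewrite /insert_fun /=.
case: (unliftP ord0 i) => [j|] ->; last by rewrite unlift_none.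
by rewrite sE liftK.
Qed.

End IteratedCross.

Section DirectSum.
Variables (R : pzRingType) (I : finType) (M : I -> lmodType R).

Definition dsum := {dffun forall i, M i}.
HB.instance Definition _ := Choice.copy dsum {dffun forall i, M i}.
Implicit Types a b : dsum.

Definition dsum_zero : dsum := [ffun i => 0].
Definition dsum_opp a : dsum := [ffun i => - a i].
Definition dsum_add a b : dsum := [ffun i => a i + b i].
Definition dsum_scale (c : R) a : dsum := [ffun i => c *: a i].

Lemma dsum_addA : associative dsum_add.
Proof. by move=> a b c; apply/ffunP => i; rewrite !ffunE addrA. Qed.
Lemma dsum_addC : commutative dsum_add.
Proof. by move=> a b; apply/ffunP => i; rewrite !ffunE addrC. Qed.
Lemma dsum_add0 : left_id dsum_zero dsum_add.
Proof. by move=> a; apply/ffunP => i; rewrite !ffunE add0r. Qed.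
Lemma dsum_addN : left_inverse dsum_zero dsum_opp dsum_add.
Proof. by move=> a; apply/ffunP => i; rewrite !ffunE addNr. Qed.
HB.instance Definition _ :=
  GRing.isZmodule.Build dsum dsum_addA dsum_addC dsum_add0 dsum_addN.

Lemma dsum_scaleA (c d : R) a :
  dsum_scale c (dsum_scale d a) = dsum_scale (c * d) a.
Proof. by apply/ffunP => i; rewrite !ffunE scalerA. Qed.
Lemma dsum_scale1 : left_id 1 dsum_scale.
Proof. by move=> a; apply/ffunP => i; rewrite !ffunE scale1r. Qed.
Lemma dsum_scaleDr : right_distributive dsum_scale +%R.
Proof. by move=> c a b; apply/ffunP => i; rewrite !ffunE scalerDr. Qed.
Lemma dsum_scaleDl a : {morph dsum_scale^~ a : c d / c + d}.
Proof. by move=> c d; apply/ffunP => i; rewrite !ffunE scalerDl. Qed.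
HB.instance Definition _ := GRing.Zmodule_isLmodule.Build R dsum
  dsum_scaleA dsum_scale1 dsum_scaleDr dsum_scaleDl.

Lemma dsumDE a b i : (a + b) i = a i + b i. Proof. by rewrite ffunE. Qed.
Lemma dsum0E i : (0 : dsum) i = 0. Proof. by rewrite ffunE. Qed.
Lemma dsumZE c a i : (c *: a) i = c *: a i. Proof. by rewrite ffunE. Qed.
Lemma dsum_sumE (T : Type) (r : seq T) (P : pred T) (F : T -> dsum) i :
  (\sum_(t <- r | P t) F t) i = \sum_(t <- r | P t) F t i.
Proof.
by apply: (big_morph (fun a : dsum => a i)) => [a b|]; rewrite ffunE.
Qed.

(* The inclusion of the summand of index i. *)
Definition dsum_in i (u : M i) : dsum :=
  [ffun j => if i =P j is ReflectT e then ecast j (M j) e u else 0].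

Lemma dsum_in_id i (u : M i) : dsum_in u i = u.
Proof. by rewrite ffunE; case: eqP => // e; rewrite eq_axiomK. Qed.

Lemma dsum_in_neq i j (u : M i) : i != j -> dsum_in u j = 0.
Proof. by rewrite ffunE; case: eqP. Qed.

Lemma dsum_in_is_linear i : linear (@dsum_in i).
Proof.
move=> c u v; apply/ffunP => j; rewrite dsumDE dsumZE.
have [<-|ij] := eqVneq i j; first by rewrite !dsum_in_id.
by rewrite !dsum_in_neq // scaler0 addr0.
Qed.
HB.instance Definition _ i :=
  GRing.isLinear.Build R (M i) dsum *:%R (@dsum_in i) (@dsum_in_is_linear i).

Lemma dsum_decomp a : a = \sum_i dsum_in (a i).
Proof.
apply/ffunP => j; rewrite dsum_sumE (bigD1 j) //= dsum_in_id big1 ?addr0 // => i.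
exact: dsum_in_neq.
Qed.

End DirectSum.

(* Algebraic actions of a finite group. As in MathComp, these are right       *)
(* actions: h maps X^g to X^(g ^ h), where g ^ h = h^-1 * g * h, and the      *)
(* product of permutations is composed from left to right. A left action is   *)
(* turned into a right action by letting g act as g^-1.                       *)
Record algact (k : closedFieldType) (gT : finGroupType) (X : qpvar k) := AlgAct {
  to_act :> X -> gT -> X;
  to_act1 : forall x, to_act x 1%g = x;
  to_actM : forall x g h, to_act x (g * h)%g = to_act (to_act x g) h;
  to_act_regular : forall g, regular (fun x => to_act x g)
}.

Section Delocalized.
Variables (k : closedFieldType) (R : comAlgType rat) (H : cross_theory k R).
Variables (gT : finGroupType) (X : qpvar k) (to : algact gT X).
Implicit Types (g h : gT) (K : {group gT}).

Lemma to_actK g : cancel (to^~ g) (to^~ g^-1%g).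
Proof. by move=> x; rewrite -to_actM mulgV to_act1. Qed.
Lemma to_actKV g : cancel (to^~ g^-1%g) (to^~ g).
Proof. by move=> x; rewrite -to_actM mulVg to_act1. Qed.

Definition fixv g : qpvar k := subv (zariski_closed_fixed (to_act_regular to g)).

Definition iso_act g : qpiso X X :=
  mk_iso (to_actK g) (to_actKV g) (to_act_regular to g)
    (to_act_regular to g^-1%g).

Lemma iso_conj_subproof h g x : to x g = x <-> to (to x h) (g ^ h)%g = to x h.
Proof.
rewrite -to_actM -conjgC to_actM; split=> [-> //|E].
by rewrite -[RHS](to_actK h) -E to_actK.
Qed.

Definition iso_conj h g : qpiso (fixv g) (fixv (g ^ h)%g) :=
  iso_restrict _ _ (f := iso_act h) (iso_conj_subproof h g).

Definition Hfix := dsum (fun g => H (fixv g)).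
HB.instance Definition _ := GRing.Lmodule.on Hfix.
Implicit Types a b : Hfix.

Definition Hin g (u : H (fixv g)) : Hfix := @dsum_in R gT (fun g => H (fixv g)) g u.
HB.instance Definition _ g := GRing.isLinear.Build R (H (fixv g)) Hfix *:%R
  (@Hin g) (@dsum_in_is_linear R gT (fun g => H (fixv g)) g).

(* The action of h on the sum of the H(X^g). *)
Definition Hact h a : Hfix := \sum_g Hin (push H (iso_conj h g) (a g)).

Lemma Hact_is_linear h : linear (Hact h).
Proof.
move=> c a b; rewrite /Hact scaler_sumr -big_split; apply: eq_bigr => g _.
by rewrite dsumDE dsumZE !linearP.
Qed.
HB.instance Definition _ h :=
  GRing.isLinear.Build R Hfix Hfix *:%R (Hact h) (Hact_is_linear h).

Lemma Hin_push Y g h (f : qpiso Y (fixv g)) (f' : qpiso Y (fixv h)) (u : H Y) :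
  g = h -> (forall y, sval (f y) = sval (f' y)) ->
  Hin (push H f u) = Hin (push H f' u).
Proof.
move=> gh; subst h => ff'; congr Hin; apply: push_ext => y.
case: (f y) (f' y) (ff' y) => [x hx] [x' hx'] /= xx'.
by apply: eq_exist.
Qed.

Lemma Hact_in h g u : Hact h (Hin u) = Hin (push H (iso_conj h g) u).
Proof.
rewrite /Hact (bigD1 g) //= [Hin u g]dsum_in_id big1 ?addr0 // => g' g'g.
by rewrite [Hin u g']dsum_in_neq 1?eq_sym // !linear0.
Qed.

Lemma Hact_sum h a : Hact h a = \sum_g Hact h (Hin (a g)).
Proof. by apply: eq_bigr => g _; rewrite Hact_in. Qed.

Lemma HactM g h a : Hact (g * h)%g a = Hact h (Hact g a).
Proof.
rewrite [RHS]linear_sum; apply: eq_bigr => x _ /=.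
rewrite Hact_in -push_comp; apply: Hin_push; first by rewrite conjgM.
by move=> y /=; rewrite to_actM.
Qed.

(* H^K(X), as the submodule of K-invariant elements supported on K of the     *)
(* sum over all g in G.                                                       *)
Definition Hinv K : {pred Hfix} := fun a =>
  [forall g, (g \notin K) ==> (a g == 0)] && [forall h in K, Hact h a == a].

Lemma HinvP K a :
  reflect ((forall g, g \notin K -> a g = 0) /\
           (forall h, h \in K -> Hact h a = a)) (a \in Hinv K).
Proof.
apply: (iffP andP) => -[h1 h2]; split.
- by move=> g gK; have /forallP/(_ g)/implyP/(_ gK)/eqP := h1.
- by move=> h hK; apply/eqP; exact: (forall_inP h2).
- by apply/forallP => g; apply/implyP => /h1 ->.
- by apply/forall_inP => h /h2 ->.
Qed.

Lemma Hinv_submod_closed K : submod_closed (Hinv K).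
Proof.
split; first by apply/HinvP; split=> [g _|h _]; rewrite ?dsum0E ?linear0.
move=> c a b /HinvP[a0 ai] /HinvP[b0 bi]; apply/HinvP; split.
  by move=> g gK; rewrite dsumDE dsumZE a0 // b0 // scaler0 addr0.
by move=> h hK; rewrite linearP /= ai // bi.
Qed.
HB.instance Definition _ K :=
  GRing.isSubmodClosed.Build R Hfix (Hinv K) (Hinv_submod_closed K).

Record HG K := MkHG { HG_val : Hfix; HG_inv : HG_val \in Hinv K }.
HB.instance Definition _ K := [isSub for @HG_val K].
HB.instance Definition _ K := [Choice of HG K by <:].
HB.instance Definition _ K := [SubChoice_isSubLmodule of HG K by <:].

Lemma HG_val_is_linear K : linear (@HG_val K).
Proof. by move=> c a b; rewrite -![HG_val _]/(val _) linearP. Qed.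
HB.instance Definition _ K := GRing.isLinear.Build R (HG K) Hfix *:%R
  (@HG_val K) (@HG_val_is_linear K).

Lemma Hinv_supp K (a : HG K) g : g \notin K -> HG_val a g = 0.
Proof. by have [h _] := HinvP _ _ (HG_inv a); apply: h. Qed.

Lemma Hact_inv K (a : HG K) h : h \in K -> Hact h (HG_val a) = HG_val a.
Proof. by have [_] := HinvP _ _ (HG_inv a); apply. Qed.

Lemma push_conj_inv K (a : HG K) h g : h \in K ->
  push H (iso_conj h g) (HG_val a g) = HG_val a (g ^ h)%g.
Proof.
move=> hK; rewrite -[in RHS](Hact_inv a hK) /Hact dsum_sumE (bigD1 g) //=.
rewrite [Hin _ _]dsum_in_id big1 ?addr0 // => g' g'g.
by rewrite [Hin _ _]dsum_in_neq // (inj_eq (conjg_inj h)).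
Qed.

(* Induction from a subgroup K to the whole group, as a sum over the cosets   *)
(* Kg; by K-invariance it does not depend on the chosen representatives.      *)
Lemma Ind_subproof K (a : HG K) :
  \sum_(C in rcosets K [set: gT]) Hact (repr C) (HG_val a)
    \in Hinv [set: gT]%G.
Proof.
have HK C g : C \in rcosets K [set: gT] -> g \in C ->
    Hact (repr C) (HG_val a) = Hact g (HG_val a).
  case/rcosetsP => x _ -> gC.
  have [u uK ->] := rcosetP (mem_repr_rcoset K x).
  have [v vK ->] := rcosetP gC.
  by rewrite !HactM (Hact_inv a uK) (Hact_inv a vK).
apply/HinvP; split=> [g|h _]; first by rewrite inE.
have stab (C : {set gT}) : (C :* h \in rcosets K [set: gT])%g = (C \in rcosets K [set: gT]).
  apply/rcosetsP/rcosetsP => -[x _ E].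
    exists (x * h^-1)%g; first by rewrite inE.
    by rewrite rcosetM -E -rcosetM mulgV rcoset1.
  by exists (x * h)%g; rewrite ?inE // E rcosetM.
rewrite linear_sum [RHS](reindex_inj (@rcoset_inj gT h)) /=.
apply: eq_big => [C|C hC]; first by rewrite stab.
rewrite -HactM; apply/esym/HK; first by rewrite stab.
case/rcosetsP: hC => x _ ->; rewrite mem_rcoset mulgK.
exact: mem_repr_rcoset.
Qed.

Definition Ind K (a : HG K) : HG [set: gT]%G := MkHG (Ind_subproof a).

(* An invariant element of the K-stable summand H(X^g), for g in K. *)
Lemma HG_in_subproof K g (u : H (fixv g)) : g \in K ->
  (forall h, h \in K -> Hact h (Hin u) = Hin u) -> Hin u \in Hinv K.
Proof.
move=> gK hu; apply/HinvP; split=> // h hK; apply: dsum_in_neq.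
by apply: contraNneq hK => <-.
Qed.
Definition HG_in K g (u : H (fixv g)) (gK : g \in K)
  (hu : forall h, h \in K -> Hact h (Hin u) = Hin u) : HG K :=
  MkHG (HG_in_subproof gK hu).

End Delocalized.

Section DelocalizedCross.
Variables (k : closedFieldType) (R : comAlgType rat) (H : cross_theory k R).

Lemma Hinv_push (gT : finGroupType) (X : qpvar k) (to : algact gT X)
    (K : {group gT}) (a : Hfix H to) :
  (forall g, g \notin K -> a g = 0) ->
  (forall h g, h \in K -> push H (iso_conj to h g) (a g) = a (g ^ h)%g) ->
  a \in Hinv K.
Proof.
move=> a0 ai; apply/HinvP; split=> // h hK.
rewrite [RHS]dsum_decomp [RHS](reindex_inj (conjg_inj h)).
by apply: eq_bigr => g _; rewrite ai.
Qed.

Variables (gT gT' : finGroupType) (X X' : qpvar k).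
Variables (to : algact gT X) (to' : algact gT' X').

Definition prod_act_fun (x : prodv X X') (g : gT * gT') : prodv X X' :=
  (to x.1 g.1, to' x.2 g.2).

Lemma prod_act1 x : prod_act_fun x 1%g = x.
Proof. by case: x => x x'; rewrite /prod_act_fun /= !to_act1. Qed.
Lemma prod_actM x g h :
  prod_act_fun x (g * h)%g = prod_act_fun (prod_act_fun x g) h.
Proof. by rewrite /prod_act_fun /= !to_actM. Qed.
Lemma prod_act_regular g : regular (fun x => prod_act_fun x g).
Proof.
apply: regular_pair.
  exact: (regular_comp (@regular_fst k X X') (to_act_regular to g.1)).
exact: (regular_comp (@regular_snd k X X') (to_act_regular to' g.2)).
Qed.
Definition prod_act : algact (gT * gT')%type (prodv X X') :=
  AlgAct prod_act1 prod_actM prod_act_regular.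

Lemma iso_fixprod_fixed (g : gT * gT')
    (x : prodv (fixv to g.1) (fixv to' g.2)) :
  prod_act (sval x.1, sval x.2) g = (sval x.1, sval x.2).
Proof.
by case: x => -[x xP] [x' x'P]; rewrite /= /prod_act_fun /= xP x'P.
Qed.

Lemma iso_fixprod_subproof (g : gT * gT') :
  is_qpiso (fun x : prodv (fixv to g.1) (fixv to' g.2) =>
    exist _ (sval x.1, sval x.2) (iso_fixprod_fixed x) : fixv prod_act g).
Proof.
split.
  apply: regular_sub; apply: regular_pair.
    by apply: (regular_comp (@regular_fst k (fixv to g.1) (fixv to' g.2)));
       apply: regular_val.
  by apply: (regular_comp (@regular_snd k (fixv to g.1) (fixv to' g.2)));
     apply: regular_val.
have h1 (x : fixv prod_act g) : to (sval x).1 g.1 = (sval x).1.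
  by case: x => x /= /(congr1 fst).
have h2 (x : fixv prod_act g) : to' (sval x).2 g.2 = (sval x).2.
  by case: x => x /= /(congr1 snd).
exists (fun x : fixv prod_act g =>
  ((exist _ (sval x).1 (h1 x) : fixv to g.1,
    exist _ (sval x).2 (h2 x) : fixv to' g.2)
  : prodv (fixv to g.1) (fixv to' g.2))).
split=> [[[x xP] [x' x'P]]|[[x x'] xP]|].
- by congr (_, _); apply: eq_exist.
- exact: eq_exist.
by apply: regular_pair; apply: regular_sub;
   apply: (regular_comp (@regular_val k _ _ _));
   [apply: regular_fst | apply: regular_snd].
Qed.

Definition iso_fixprod (g : gT * gT') :
  qpiso (prodv (fixv to g.1) (fixv to' g.2)) (fixv prod_act g) :=
  QPIso (iso_fixprod_subproof g).

Lemma HG_cross_subproof (a : HG H to [set: gT]) (b : HG H to' [set: gT']) :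
  ([ffun g => push H (iso_fixprod g) (cross H (HG_val a g.1) (HG_val b g.2))]
    : Hfix H prod_act) \in Hinv [set: gT * gT']%G.
Proof.
apply: Hinv_push => [g|h g _]; first by rewrite inE.
rewrite !ffunE -(push_conj_inv a (h := h.1) g.1) ?inE //.
rewrite -(push_conj_inv b (h := h.2) g.2) ?inE //.
rewrite cross_push -!push_comp; apply: push_ext => -[[x xP] [x' x'P]].
exact: eq_exist.
Qed.

Definition HG_cross (a : HG H to [set: gT]) (b : HG H to' [set: gT']) :
  HG H prod_act [set: gT * gT'] := MkHG (HG_cross_subproof a b).

End DelocalizedCross.

(* Transport along an isomorphism that is equivariant for a group morphism    *)
(* rho, from H^G(X) to H^(rho(G))(X').                               *)
Section Transport.
Variables (k : closedFieldType) (R : comAlgType rat) (H : cross_theory k R).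
Variables (gT gT' : finGroupType) (X X' : qpvar k).
Variables (to : algact gT X) (to' : algact gT' X').
Variables (rho : {morphism [set: gT] >-> gT'}) (phi : qpiso X X').
Hypothesis (phi_eq : forall x g, phi (to x g) = to' (phi x) (rho g)).

Lemma iso_fixeq_subproof g x : to x g = x <-> to' (phi x) (rho g) = phi x.
Proof.
have [_ [psi [phiK _ _]]] := iso_prf phi.
by rewrite -phi_eq; split=> [-> //|/(congr1 psi)]; rewrite !phiK.
Qed.

Definition iso_fixeq g : qpiso (fixv to g) (fixv to' (rho g)) :=
  iso_restrict _ _ (f := phi) (iso_fixeq_subproof g).

Lemma HG_transport_subproof (a : HG H to [set: gT]) :
  \sum_g Hin (push H (iso_fixeq g) (HG_val a g))
    \in Hinv (rho @* [set: gT])%G.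
Proof.
apply/HinvP; split=> [g' g'rho|h' /morphimP[h _ _ ->]].
  rewrite dsum_sumE big1 // => g _; apply: dsum_in_neq.
  by apply: contraNneq g'rho => <-; rewrite mem_morphim ?inE.
rewrite linear_sum [RHS](reindex_inj (conjg_inj h)); apply: eq_bigr => g _ /=.
rewrite Hact_in -(push_conj_inv a) ?inE // -!push_comp.
apply: Hin_push; first by rewrite morphJ ?inE.
by move=> x /=; rewrite phi_eq.
Qed.

Definition HG_transport (a : HG H to [set: gT]) :
  HG H to' (rho @* [set: gT]) := MkHG (HG_transport_subproof a).

End Transport.

Section SymmetricGroups.
Variables (k : closedFieldType) (R : comAlgType rat) (H : cross_theory k R).
Variable Z : qpvar k.

(* The permutation s moves the i-th factor of Z^n to position s i. *)
Definition perm_act_fun n (z : powv Z n) (s : 'S_n) : powv Z n :=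
  fun i => z ((s^-1)%g i).

Lemma perm_act1 n (z : powv Z n) : perm_act_fun z 1%g = z.
Proof. by apply/funext => i; rewrite /perm_act_fun invg1 perm1. Qed.
Lemma perm_actM n (z : powv Z n) (s t : 'S_n) :
  perm_act_fun z (s * t)%g = perm_act_fun (perm_act_fun z s) t.
Proof. by apply/funext => i; rewrite /perm_act_fun invMg permM. Qed.
Lemma perm_act_regular n (s : 'S_n) : regular (fun z : powv Z n => perm_act_fun z s).
Proof. by apply: regular_tuple => i; apply: regular_proj. Qed.
Definition perm_act n : algact 'S_n (powv Z n) :=
  AlgAct (@perm_act1 n) (@perm_actM n) (@perm_act_regular n).

Definition HSym n := HG H (perm_act n) [set: 'S_n].
HB.instance Definition _ n := GRing.Lmodule.on (HSym n).

Definition perm_cat_fun m n (st : 'S_m * 'S_n) (i : 'I_(m + n)) : 'I_(m + n) :=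
  match split i with
  | inl a => lshift n (st.1 a)
  | inr b => rshift m (st.2 b)
  end.

Lemma perm_cat_funl m n st a :
  @perm_cat_fun m n st (lshift n a) = lshift n (st.1 a).
Proof. by rewrite /perm_cat_fun -[lshift n a]/(unsplit (inl a)) unsplitK. Qed.
Lemma perm_cat_funr m n st b :
  @perm_cat_fun m n st (rshift m b) = rshift m (st.2 b).
Proof. by rewrite /perm_cat_fun -[rshift m b]/(unsplit (inr b)) unsplitK. Qed.

Lemma perm_cat_fun_inj m n st : injective (@perm_cat_fun m n st).
Proof.
apply: (can_inj (g := perm_cat_fun (st.1^-1, st.2^-1)%g)) => i.
by case: (split_ordP i) => a ->;
   rewrite ?(perm_cat_funl, perm_cat_funr) /= permK.
Qed.

Definition perm_cat m n (st : 'S_m * 'S_n) : 'S_(m + n) :=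
  perm (@perm_cat_fun_inj m n st).

Lemma perm_cat_morphM m n :
  {in [set: 'S_m * 'S_n] &, {morph @perm_cat m n : x y / (x * y)%g}}.
Proof.
move=> x y _ _; apply/permP => i; rewrite permM !permE.
by case: (split_ordP i) => a ->;
   rewrite ?(perm_cat_funl, perm_cat_funr) /= permM.
Qed.
Canonical perm_cat_morphism m n := Morphism (@perm_cat_morphM m n).

Lemma perm_cat_injm m n : ('injm (perm_cat_morphism m n))%g.
Proof.
apply/injmP => -[s t] [s' t'] _ _ /= /permP E; congr (_, _).
  apply/permP => a; have := E (lshift n a); rewrite !permE !perm_cat_funl.
  exact: lshift_inj.
apply/permP => b; have := E (rshift m b); rewrite !permE !perm_cat_funr.
exact: rshift_inj.
Qed.

Lemma perm_cat_act m n (x : prodv (powv Z m) (powv Z n)) (st : 'S_m * 'S_n) :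
  iso_cat Z m n (prod_act (perm_act m) (perm_act n) x st) =
  perm_act (m + n) (iso_cat Z m n x) (perm_cat_morphism m n st).
Proof.
case: x st => z w st /=; apply/funext => i; rewrite /perm_act_fun.
have -> : ((perm_cat st)^-1)%g i = perm_cat (st.1^-1, st.2^-1)%g i.
  apply: (@perm_inj _ (perm_cat st)); rewrite permKV !permE.
  by case: (split_ordP i) => a ->;
     rewrite ?(perm_cat_funl, perm_cat_funr) /= permKV.
rewrite permE.
by case: (split_ordP i) => a ->; rewrite ?(perm_cat_funl, perm_cat_funr);
   rewrite -?[lshift n _]/(unsplit (inl _)) -?[rshift m _]/(unsplit (inr _))
           !unsplitK.
Qed.

Definition odot m n (a : HSym m) (b : HSym n) : HSym (m + n) :=
  Ind (HG_transport (@perm_cat_act m n) (HG_cross a b)).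

Lemma trivial_group_inv n (g : 'S_n) (u : H (fixv (perm_act n) g)) : n = 0%N ->
  forall h, h \in [set: 'S_n]%G -> Hact h (Hin u) = Hin u.
Proof.
move=> n0 h _; have -> : h = 1%g.
  by apply/permP => i; exfalso; move: i; rewrite n0 => -[].
rewrite Hact_in -[in RHS](push_id u); apply: Hin_push; first by rewrite conjg1.
by move=> x /=; rewrite perm_act1.
Qed.

Lemma iso_fix1_subproof n (z : powv Z n) : perm_act n z 1%g = z.
Proof. exact: perm_act1. Qed.

Lemma is_qpiso_fix1 n : is_qpiso (fun z : powv Z n =>
  exist _ z (iso_fix1_subproof z) : fixv (perm_act n) 1%g).
Proof.
split; first by apply: regular_sub; apply: regular_id.
exists (fun z : fixv (perm_act n) 1%g => sval z); split=> [//|z|].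
  by case: z => z zP; apply: eq_exist.
exact: regular_val.
Qed.
Definition iso_fix1 n : qpiso (powv Z n) (fixv (perm_act n) 1%g) :=
  QPIso (@is_qpiso_fix1 n).

(* The unit 1_pt in H^(Sigma_0)(Z^0) = H(pt). *)
Definition HSym_one : HSym 0 :=
  HG_in (K := [set: 'S_0]%G) (u := push H (iso_fix1 0)
    (push H (iso_pow0 Z) (cross_one H))) (in_setT _)
    (trivial_group_inv _ erefl).

(* H^Sigma(Z): formal series in t, the n-th coefficient in H^(Sigma_n)(Z^n). *)
Definition hseries := forall n, HSym n.

Definition HSym_cast m n (e : m = n) (a : HSym m) : HSym n :=
  ecast i (HSym i) e a.

Definition hone : hseries :=
  fun n => match n return HSym n with 0 => HSym_one | _.+1 => 0 end.

Definition hmul (A B : hseries) : hseries := fun n =>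
  \sum_(i < n.+1) HSym_cast (subnKC (leq_ord i)) (odot (A i) (B (n - i)%N)).

Definition hpow (A : hseries) (m : nat) : hseries := iter m (hmul A) hone.

(* The exponential of a series without constant term: the coefficient of t^n  *)
(* of its m-th power is then 0 for m > n (hpow_eq0 below).                    *)
Definition hexp (A : hseries) : hseries := fun n =>
  \sum_(m < n.+1) ((m`!%:R^-1 : rat)%:A : R) *: hpow A m n.

Definition rcycle r : 'S_r := perm (@ordS_inj r).

End SymmetricGroups.

Section CreationOperators.
Variables (k : closedFieldType) (R : comAlgType rat) (H : cross_theory k R).
Variable Z : qpvar k.

Lemma perm_fixP n (s : 'S_n) (z : powv Z n) :
  perm_act Z n z s = z <-> forall i, z (s i) = z i.
Proof.
split=> [E i|E].
  by rewrite -[in LHS]E /perm_act /= /perm_act_fun permK.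
apply/funext => i; rewrite /perm_act /= /perm_act_fun.
by rewrite -[in RHS](permKV s i) E.
Qed.

Lemma Hact_cent n (s g : 'S_n) Y (f : qpiso Y (fixv (perm_act Z n) s))
    (e : qpiso Y Y) (u : H Y) : g \in 'C[s]%g ->
  (forall y i, sval (f y) ((g^-1)%g i) = sval (f (e y)) i) ->
  push H e u = u ->
  Hact g (Hin (push H f u)) = Hin (push H f u).
Proof.
move=> /cent1P gs fe eu; rewrite Hact_in -[in RHS]eu -!push_comp.
apply: Hin_push; first by rewrite conjgE -gs mulKg.
by move=> y; apply/funext => i; apply: fe.
Qed.

(* For r > 0 the diagonal of Z^r is the fixed locus of the r-cycle.           *)
Lemma diag_fixed r (z : Z) :
  perm_act Z r ((fun=> z) : powv Z r) (rcycle r) = (fun=> z).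
Proof. exact/perm_fixP. Qed.

Lemma rcycle_fixed r (y : fixv (perm_act Z r.+1) (rcycle r.+1)) i :
  sval y i = sval y ord0.
Proof.
case: y => z /perm_fixP hz /=; case: i => m; elim: m => [|m IHm] lt_mr.
  by congr z; apply: val_inj.
rewrite -(IHm (ltnW lt_mr)) -[RHS]hz permE; congr z; apply: val_inj => /=.
by rewrite modn_small.
Qed.

Lemma iso_diag_subproof r : is_qpiso (fun z : Z =>
  exist _ (fun=> z) (diag_fixed r.+1 z) : fixv (perm_act Z r.+1) (rcycle r.+1)).
Proof.
split.
  by apply: regular_sub; apply: regular_tuple => i; apply: regular_id.
exists (fun y : fixv (perm_act Z r.+1) (rcycle r.+1) => sval y ord0).
split=> [//|y|].
  have := rcycle_fixed y; case: y => y yP /= hy.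
  by apply: eq_exist; apply/funext => i; rewrite hy.
exact: (regular_comp (@regular_val k (powv Z r.+1) _ _)
                     (@regular_proj k Z r.+1 ord0)).
Qed.
Definition iso_diag r : qpiso Z (fixv (perm_act Z r.+1) (rcycle r.+1)) :=
  QPIso (iso_diag_subproof r).

Lemma creation_subproof r (c : H Z) h : h \in <[rcycle r.+1]>%G ->
  Hact h (Hin (push H (iso_diag r) c)) = Hin (push H (iso_diag r) c).
Proof.
move=> hr; apply: (Hact_cent (e := iso_id Z)) => //; last exact: push_id.
by apply: subsetP hr; rewrite cycle_subG; apply/cent1P.
Qed.

(* The creation operator of index r + 1.                                      *)
Definition creation r (c : H Z) : HSym H Z r.+1 :=
  Ind (HG_in (cycle_id (rcycle r.+1)) (@creation_subproof r (c *+ r.+1))).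

(* The cycles of s (including fixed points), by increasing length.            *)
Definition cycles n (s : 'S_n) : seq {set 'I_n} :=
  sort (fun A B : {set 'I_n} => #|A| <= #|B|)%N (enum (porbits s)).

Lemma mem_cycles n (s : 'S_n) A : (A \in cycles s) = (A \in porbits s).
Proof. by rewrite mem_sort mem_enum. Qed.

Lemma cycle_idx_subproof n (s : 'S_n) i :
  (index (porbit s i) (cycles s) < size (cycles s))%N.
Proof. by rewrite index_mem mem_cycles imset_f. Qed.
Definition cycle_idx n (s : 'S_n) i : 'I_(size (cycles s)) :=
  Ordinal (cycle_idx_subproof s i).

Lemma nth_cycle_idx n (s : 'S_n) i :
  nth set0 (cycles s) (cycle_idx s i) = porbit s i.
Proof. by rewrite nth_index // mem_cycles imset_f. Qed.

Lemma cycle_idx_eq n (s : 'S_n) i j :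
  (cycle_idx s i == cycle_idx s j) = (porbit s i == porbit s j).
Proof.
apply/eqP/eqP => [E|E]; first by rewrite -!nth_cycle_idx E.
by apply: val_inj; rewrite /= E.
Qed.

Lemma cycle_idx_surj n (s : 'S_n) (a : 'I_(size (cycles s))) :
  exists i, cycle_idx s i == a.
Proof.
have : nth set0 (cycles s) a \in porbits s by rewrite -mem_cycles mem_nth.
case/imsetP => i _ E; exists i; apply/eqP/val_inj => /=.
by rewrite -E index_uniq // sort_uniq enum_uniq.
Qed.
Definition cycle_repr n (s : 'S_n) a : 'I_n := xchoose (@cycle_idx_surj n s a).
Lemma cycle_reprK n (s : 'S_n) : cancel (@cycle_repr n s) (cycle_idx s).
Proof. by move=> a; apply/eqP; exact: (xchooseP (@cycle_idx_surj n s a)). Qed.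

Lemma cycles_fixed n (s : 'S_n) (z : powv Z (size (cycles s))) :
  perm_act Z n (fun i => z (cycle_idx s i)) s = (fun i => z (cycle_idx s i)).
Proof.
apply/perm_fixP => i; congr z; apply/eqP; rewrite cycle_idx_eq.
by have := porbit_perm s 1 i; rewrite expg1 => ->.
Qed.

Lemma fixed_cycles n (s : 'S_n) (y : fixv (perm_act Z n) s) i j :
  porbit s i = porbit s j -> sval y i = sval y j.
Proof.
case: y => z /perm_fixP hz /= E.
have /porbitP[m ->] : j \in porbit s i by rewrite E porbit_id.
elim: m => [|m IHm]; first by rewrite expg0 perm1.
by rewrite expgSr permM hz.
Qed.

Lemma iso_cycles_subproof n (s : 'S_n) :
  is_qpiso (fun z : powv Z (size (cycles s)) =>
    exist _ (fun i => z (cycle_idx s i)) (cycles_fixed z)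
    : fixv (perm_act Z n) s).
Proof.
split.
  by apply: regular_sub; apply: regular_tuple => i; apply: regular_proj.
exists (fun y : fixv (perm_act Z n) s => fun a => sval y (cycle_repr a)).
split=> [z|y|].
- by apply/funext => a /=; rewrite cycle_reprK.
- have hy := fixed_cycles y; case: y hy => y yP /= hy.
  apply: eq_exist; apply/funext => i; apply: hy; apply/eqP.
  by rewrite -cycle_idx_eq cycle_reprK.
apply: regular_tuple => a.
exact: (regular_comp (@regular_val k (powv Z n) _ _) (regular_proj _)).
Qed.
(* (Z^n)^s = prod_r Z^(k_r), for s with k_r cycles of length r.               *)
Definition iso_cycles n (s : 'S_n) :
  qpiso (powv Z (size (cycles s))) (fixv (perm_act Z n) s) :=
  QPIso (iso_cycles_subproof s).

Lemma porbit_cent n (s g : 'S_n) i : g \in 'C[s]%g ->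
  porbit s (g i) = g @: porbit s i.
Proof.
move=> /cent1P gs; have gsX m x : (s ^+ m)%g (g x) = g ((s ^+ m)%g x).
  by rewrite -!permM; congr (fun_of_perm _ x); apply: commuteX.
apply/setP => x; apply/porbitP/imsetP => [[m ->]|[y /porbitP[m ->] ->]].
  by exists ((s ^+ m)%g i); rewrite ?gsX // mem_porbit.
by exists m; rewrite gsX.
Qed.

(* The cross-product over r of the k_r-fold cross-powers of b_r.              *)
Definition cycle_class n (b : nat -> H Z) (s : 'S_n) :
    H (fixv (perm_act Z n) s) :=
  push H (iso_cycles s)
    (bigcross (fun a : 'I_(size (cycles s)) => b #|nth set0 (cycles s) a|)).

Lemma cycle_class_subproof n b (s : 'S_n) g : g \in 'C[s]%G ->
  Hact g (Hin (cycle_class b s)) = Hin (cycle_class b s).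
Proof.
move=> gs; have gVs : (g^-1)%g \in 'C[s]%g by rewrite groupV.
pose t (a : 'I_(size (cycles s))) := cycle_idx s ((g^-1)%g (cycle_repr a)).
have tE i : t (cycle_idx s i) = cycle_idx s ((g^-1)%g i).
  have E : porbit s (cycle_repr (cycle_idx s i)) = porbit s i.
    by apply/eqP; rewrite -cycle_idx_eq cycle_reprK.
  by apply/eqP; rewrite cycle_idx_eq !porbit_cent // E.
have t_inj : injective t.
  move=> a a' /eqP.
  rewrite cycle_idx_eq !porbit_cent // => /eqP/(imset_inj perm_inj) E.
  rewrite -[LHS]cycle_reprK -[RHS]cycle_reprK.
  by apply/eqP; rewrite cycle_idx_eq E.
apply: (Hact_cent (e := iso_reindex Z (perm t_inj))) => //.
  by move=> z i /=; rewrite (permE t_inj) tE.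
rewrite -bigcross_reindex; congr bigcross; apply/funext => a; congr (b _).
rewrite permE -(cycle_reprK a); move: (cycle_repr a) => i.
by rewrite tE !nth_cycle_idx porbit_cent // card_imset //; apply: perm_inj.
Qed.

Definition bsigma n (b : nat -> H Z) (s : 'S_n) : HSym H Z n :=
  Ind (HG_in (cent1id s) (@cycle_class_subproof n b s)).

End CreationOperators.

Section Exponential.
Variables (k : closedFieldType) (R : comAlgType rat) (H : cross_theory k R).
Variable Z : qpvar k.

Lemma Ind0 (gT : finGroupType) (X : qpvar k) (to : algact gT X)
    (K : {group gT}) : Ind (0 : HG H to K) = 0.
Proof.
by apply: val_inj => /=; rewrite big1 // => C _; rewrite !linear0.
Qed.

Lemma odot0 m n (a : HSym H Z m) (b : HSym H Z n) :
  a = 0 \/ b = 0 -> odot a b = 0.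
Proof.
move=> ab0; rewrite /odot; set c := HG_cross a b.
suff : HG_val c = 0.
  move=> c0; clearbody c; suff -> : HG_transport (@perm_cat_act _ Z m n) c = 0 by apply: Ind0.
  apply: val_inj => /=; rewrite big1 // => g _.
  by rewrite c0 dsum0E !linear0.
apply/ffunP => g; rewrite ffunE dsum0E.
have E0 p (x : HSym H Z p) s : x = 0 -> HG_val x s = 0.
  by move=> ->; rewrite linear0 dsum0E.
by case: ab0 => /E0 ->; rewrite ?cross0l ?cross0r linear0.
Qed.

Lemma HSym_cast0 m n (e : m = n) : HSym_cast e (0 : HSym H Z m) = 0.
Proof. by case: _ / e. Qed.

Lemma hpow_eq0 (A : hseries H Z) m n : A 0 = 0 -> (n < m)%N -> hpow A m n = 0.
Proof.
move=> A0; elim: m n => [|m IHm] n //; rewrite ltnS => nm.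
rewrite /hpow iterS -/(hpow A m) /hmul big1 // => i _.
have -> : odot (A i) (hpow A m (n - i)%N) = 0.
  apply: odot0; case: i => -[|i] lt_in /=; [by left | right].
  apply: IHm; apply: leq_trans nm; rewrite ltn_subrL //.
  by rewrite ltnS in lt_in; apply: leq_trans lt_in.
exact: HSym_cast0.
Qed.

End Exponential.

(* Main.v *)
(* Every coefficient at hand is a combination, with natural multiplicities    *)
(* c(g) depending only on the class of g, of the components [cycle_class b g] *)
(* in H((Z^n)^g).                                                             *)
(* Cycle classes are permuted by conjugation and multiplicative for the       *)
(* block sum S_m x S_n -> S_(m + n), so induction and [odot] only act on the  *)
(* multiplicities: the coset sum defining [odot] runs over the m-subsets A of *)
(* {0, ..., m + n - 1}, and g contributes for A exactly when it stabilises A. *)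
(* The series in the exponential has multiplicity 1 at the permutations with  *)
(* a single cycle, hence its m-th power counts the orderings of the cycles    *)
(* of g, i.e. has multiplicity m! if g has m cycles and 0 otherwise; dividing *)
(* by m! and summing over m gives multiplicity 1 everywhere, which is also    *)
(* that of the sum over the conjugacy classes.                                *)

Require Import Defs.
From HB Require Import structures.
From mathcomp Require Import all_boot all_order all_algebra all_fingroup.
From mathcomp Require Import complex boolp reals.

Set Implicit Arguments.
Unset Strict Implicit.
Unset Printing Implicit Defensive.

Import Order.TTheory GRing.Theory Num.Theory.
Local Open Scope ring_scope.

(* [perm_cat] also names a lemma on [perm_eq] in [seq]. *)
Local Notation perm_cat := Defs.perm_cat.

(** * Cycles of permutations *)

(** The theorem is a count of permutations by their cycles. A permutation with m cycles arises m!
    times by listing its cycles one after another, and the m-th term of the exponential divides by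
    m!; so each permutation is produced exactly once, as it is when every conjugacy class is taken
    once. To turn this into an identity in [HSym], one element [cycle_class b g] is fixed for each
    g, and [has_mult a c] says that a has component c g times that element. By [mult_eq] it suffices
    to find multiplicity 1 on both sides. [Hact_cycle_class] (conjugation) and
    [cycle_class_perm_cat] (block sums) show that the operations respect these elements, whence
    [mult_Ind] and [mult_odot]. The combinatorics is in [sum_rcosets_cent1], used for [bsigma] and
    [creation], and in [sum_rcosets_perm_cat], used by [mult_hpow] for the powers. *)

Section PermConjugation.
Variables (T : finType).
Implicit Types (s h : {perm T}) (A : {set T}).

Lemma porbit_conj s h x : porbit (s ^ h)%g (h x) = h @: porbit s x.
Proof.
apply/setP => y; apply/porbitP/imsetP => [[k ->]|[z /porbitP[k ->] ->]].
  by exists ((s ^+ k)%g x); [exact: mem_porbit | rewrite -conjXg permJ].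
by exists k; rewrite -conjXg permJ.
Qed.

Lemma mem_porbits_conj s h A :
  (h @: A \in porbits (s ^ h)%g) = (A \in porbits s).
Proof.
apply/imsetP/imsetP => -[x _ E]; last first.
  by exists (h x); rewrite // porbit_conj E.
exists ((h^-1)%g x) => //; apply: (imset_inj (@perm_inj _ h)).
by rewrite E -porbit_conj permKV.
Qed.

Lemma card_porbits_conj s h : #|porbits (s ^ h)%g| = #|porbits s|.
Proof.
rewrite -[RHS](card_imset _ (imset_inj (@perm_inj _ h))).
apply: eq_card => A; apply/idP/imsetP => [|[B sB ->]]; last by rewrite mem_porbits_conj.
have {1 2}-> : A = h @: ((h^-1)%g @: A).
  by rewrite -imset_comp (eq_imset _ (permKV h)) imset_id.
by rewrite mem_porbits_conj => ?; exists ((h^-1)%g @: A).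
Qed.

Lemma porbit_stable s x : s @: porbit s x = porbit s x.
Proof. by rewrite -porbit_conj conjgE mulKg; have := porbit_perm s 1 x; rewrite expg1. Qed.

Lemma imset_permM s h A : (s * h)%g @: A = h @: (s @: A).
Proof. by rewrite -imset_comp; apply: eq_imset => x; rewrite permM. Qed.

Lemma imset_perm1 A : (1%g : {perm T}) @: A = A.
Proof. by rewrite (eq_imset _ (@perm1 T)) imset_id. Qed.

Lemma card_porbits_le s : (#|porbits s| <= #|T|)%N.
Proof. exact: leq_imset_card. Qed.

End PermConjugation.

(** The elements conjugating s to a given conjugate g form a single right coset of the centralizer,
    so exactly one term survives when g is conjugate to s, and none otherwise. *)
Lemma sum_rcosets_cent1 (gT : finGroupType) (K : {group gT}) (s g : gT) r :
  K :=: 'C[s]%g ->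
  (\sum_(C in rcosets K [set: gT]) (g ^ (repr C)^-1 == s)%g * r =
   (g \in s ^: [set: gT])%g * r)%N.
Proof.
move=> KE; rewrite -big_distrl /=; congr (_ * _)%N.
have E (C : {set gT}) : C \in rcosets K [set: gT] ->
    exists x, C = (K :* x)%g /\ (s ^ repr C = s ^ x)%g.
  case/rcosetsP => x _ ->; exists x; split=> //.
  have [u uK ->] := rcosetP (mem_repr_rcoset K x).
  rewrite conjgM; congr (_ ^ _)%g; apply/conjg_fixP/commgP.
  by apply/commute_sym/cent1P; rewrite -KE.
have [/imsetP[x _ ->]|gs] := boolP (g \in _); last first.
  rewrite big1 // => C _; case: eqP => // gC; case/negP: gs.
  by apply/imsetP; exists (repr C); rewrite ?inE // -gC conjgKV.
have xK : (K :* x)%g \in rcosets K [set: gT] by apply/rcosetsP; exists x; rewrite ?inE.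
(* An element y conjugates s to s ^ x exactly when x * y^-1 commutes with s, that is, when y lies in
   the coset of x. *)
have fixE y : ((s ^ x) ^ y^-1 == s)%g = (y \in K :* x)%g.
  rewrite mem_rcoset KE -conjgM -groupV invMg invgK.
  by apply/eqP/cent1P => [/conjg_fixP/commgP/commute_sym|/commute_sym/commgP/conjg_fixP].
rewrite (bigD1 (K :* x)%g) //= fixE mem_repr_rcoset big1 ?mem_imset ?inE //.
move=> C /andP[/rcosetsP[y _ ->] yx]; rewrite fixE; case: rcoset_eqP => // E'.
by case/eqP: yx; rewrite -E'; apply/esym/rcoset_eqP/mem_repr_rcoset.
Qed.

(** * The standard cycle: its powers, centralizer and conjugacy class *)

Lemma rcycle_pow r k : ((rcycle r.+1) ^+ k)%g ord0 = inord (k %% r.+1) :> 'I_r.+1.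
Proof.
elim: k => [|k IHk].
  by rewrite expg0 perm1; apply: val_inj; rewrite mod0n /= inordK.
rewrite expgSr permM IHk permE; apply: val_inj; rewrite /= !inordK ?ltn_mod //.
by rewrite -addn1 modnDml addn1.
Qed.

Lemma rcycle_powE r (i : 'I_r.+1) : ((rcycle r.+1) ^+ i)%g ord0 = i.
Proof. by rewrite rcycle_pow modn_small ?inord_val. Qed.

(** The powers of the cycle act transitively, so a permutation commuting with it is determined by
    the image of 0; that image is also the exponent of the power it equals. *)
Lemma cent1_rcycle r : 'C[rcycle r.+1]%g = <[rcycle r.+1]>%g.
Proof.
apply/eqP; rewrite eqEsubset cycle_subG cent1id andbT; apply/subsetP => x /cent1P xs.
apply/cycleP; exists (x ord0); apply/permP => i.
rewrite -[i in LHS]rcycle_powE -permM -(commuteX i xs) permM.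
rewrite -[in RHS](rcycle_powE i) -[in LHS](rcycle_powE (x ord0)) -!permM.
by rewrite -!expgD addnC.
Qed.

Lemma porbit_rcycle r i : porbit (rcycle r.+1) i = setT.
Proof.
apply/setP => j; rewrite inE -eq_porbit_mem.
have E l : porbit (rcycle r.+1) l = porbit (rcycle r.+1) ord0.
  by rewrite -[l]rcycle_powE porbit_perm.
by rewrite !E eqxx.
Qed.

Lemma card_porbits_rcycle r : #|porbits (rcycle r.+1)| = 1%N.
Proof.
apply/eqP/cards1P; exists setT; apply/setP => A; rewrite !inE.
apply/imsetP/eqP => [[i _ ->]|->]; first exact: porbit_rcycle.
by exists ord0; rewrite // porbit_rcycle.
Qed.

Lemma one_porbit_rcycle r (g : 'S_r.+1) :
  (g \in rcycle r.+1 ^: [set: 'S_r.+1])%g = (#|porbits g| == 1)%N.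
Proof.
apply/imsetP/idP => [[x _ ->]|/cards1P[A gA]].
  by rewrite card_porbits_conj card_porbits_rcycle.
have gT : porbit g ord0 = setT.
  apply/setP => i; rewrite inE -eq_porbit_mem.
  have : porbit g i \in porbits g by apply: imset_f.
  have : porbit g ord0 \in porbits g by apply: imset_f.
  by rewrite gA !inE => /eqP -> /eqP ->; rewrite eqxx.
have g_card : #|porbit g ord0| = r.+1 by rewrite gT cardsT card_ord.
(* The conjugating permutation sends i to the i-th iterate of 0 under g; it is injective because the
   orbit of 0 has r + 1 elements. *)
have x_inj : injective (fun i : 'I_r.+1 => (g ^+ i)%g ord0).
  move=> i j; rewrite !permX => E; apply: val_inj => /=.
  have := uniq_traject_porbit g ord0; rewrite g_card => g_uniq.
  have := nth_uniq ord0 (s := traject g ord0 r.+1) (i := i) (j := j).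
  rewrite size_traject !nth_traject // E eqxx.
  by move=> /(_ (ltn_ord i) (ltn_ord j) g_uniq)/esym/eqP.
exists (perm x_inj) => //; apply/permP => i.
have [j ->] : exists j, i = perm x_inj j by exists (((perm x_inj)^-1)%g i); rewrite permKV.
rewrite permJ !permE /=.
have [jr|] := ltnP j.+1 r.+1; first by rewrite modn_small // expgSr permM.
move=> rj; have jE : val j = r by apply/eqP; rewrite eqn_leq -ltnS ltn_ord.
rewrite jE modnn expg0 perm1 -permM -expgSr permX.
by have := iter_porbit g ord0; rewrite g_card.
Qed.

(** * Block sums of permutations and the cosets of the product of two symmetric groups *)

Section PermCat.
Variables m n : nat.
Implicit Types (u : 'S_m) (v : 'S_n) (w : 'S_(m + n)).

Lemma perm_cat_lshift u v a : perm_cat (u, v) (lshift n a) = lshift n (u a).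
Proof. by rewrite permE perm_cat_funl. Qed.
Lemma perm_cat_rshift u v a : perm_cat (u, v) (rshift m a) = rshift m (v a).
Proof. by rewrite permE perm_cat_funr. Qed.

Lemma perm_catX u v k : (perm_cat (u, v) ^+ k)%g = perm_cat (u ^+ k, v ^+ k)%g.
Proof.
elim: k => [|k IHk]; first exact: (esym (morph1 (perm_cat_morphism m n))).
rewrite expgSr IHk !expgSr.
exact: esym (perm_cat_morphM (x := (u ^+ k, v ^+ k)%g) (y := (u, v)) _ _);
  rewrite inE.
Qed.

Lemma porbit_perm_catl u v a :
  porbit (perm_cat (u, v)) (lshift n a) = lshift n @: porbit u a.
Proof.
apply/setP => i; apply/porbitP/imsetP => [[k ->]|[_ /porbitP[k ->] ->]].
  by exists ((u ^+ k)%g a); rewrite ?mem_porbit // perm_catX perm_cat_lshift.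
by exists k; rewrite perm_catX perm_cat_lshift.
Qed.

Lemma porbit_perm_catr u v a :
  porbit (perm_cat (u, v)) (rshift m a) = @rshift m n @: porbit v a.
Proof.
apply/setP => i; apply/porbitP/imsetP => [[k ->]|[_ /porbitP[k ->] ->]].
  by exists ((v ^+ k)%g a); rewrite ?mem_porbit // perm_catX perm_cat_rshift.
by exists k; rewrite perm_catX perm_cat_rshift.
Qed.

Lemma porbits_perm_cat u v : porbits (perm_cat (u, v)) =
  [set lshift n @: (A : {set _}) | A in porbits u] :|:
  [set @rshift m n @: (A : {set _}) | A in porbits v].
Proof.
apply/setP => A; rewrite inE; apply/imsetP/orP => [[i _ ->]|].
  case: (split_ordP i) => a ->; [left|right];
  rewrite ?porbit_perm_catl ?porbit_perm_catr; apply: imset_f;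
  exact: imset_f.
by case=> /imsetP[_ /imsetP[a _ ->] ->]; [exists (lshift n a)|exists (rshift m a)];
  rewrite ?porbit_perm_catl ?porbit_perm_catr.
Qed.

(** The base point for the action on m-subsets; its stabilizer is the image of [perm_cat], by
    [mem_im_perm_cat]. *)
Definition lshifts : {set 'I_(m + n)} := lshift n @: setT.

Lemma mem_lshifts a : lshift n a \in lshifts.
Proof. exact: imset_f. Qed.
Lemma mem_rshifts a : (rshift m a \in lshifts) = false.
Proof. by apply/negP => /imsetP[b _ /esym/eqP]; rewrite eq_lrshift. Qed.
Lemma card_lshifts : #|lshifts| = m.
Proof. by rewrite card_imset ?cardsT ?card_ord //; exact: lshift_inj. Qed.

Lemma card_porbits_perm_cat u v :
  #|porbits (perm_cat (u, v))| = (#|porbits u| + #|porbits v|)%N.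
Proof.
rewrite porbits_perm_cat cardsU.
rewrite (card_imset _ (imset_inj (@lshift_inj m n))).
rewrite (card_imset _ (imset_inj (@rshift_inj m n))).
rewrite (_ : _ :&: _ = set0) ?cards0 ?subn0 //.
apply/setP => A; rewrite !inE; apply/andP => -[].
case/imsetP=> _ /imsetP[a _ ->] -> /imsetP[B _ /setP/(_ (lshift n a))].
rewrite imset_f ?porbit_id // => /esym/imsetP[b _ /eqP].
by rewrite eq_lrshift.
Qed.

(** This trades a condition on the left factor for one on the block sum alone, which can then be
    conjugated. *)
Lemma lshifts_porbits u v :
  (lshifts \in porbits (perm_cat (u, v))) = (#|porbits u| == 1%N).
Proof.
apply/imsetP/cards1P => [[i _]|[A uA]].
  case: (split_ordP i) => a ->; last first.
    by move/setP/(_ (rshift m a)); rewrite mem_rshifts porbit_id.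
  rewrite porbit_perm_catl => /(imset_inj (@lshift_inj _ _)) uT.
  exists setT; apply/setP => B; rewrite inE; apply/imsetP/eqP => [[b _ ->]|->].
    by rewrite uT; apply/eqP; rewrite eq_porbit_mem -uT.
  by exists a.
have /imsetP[a _ Aa] : A \in porbits u by rewrite uA inE.
have AT : A = setT.
  apply/setP => b; rewrite inE Aa -eq_porbit_mem -Aa.
  have : porbit u b \in porbits u by apply: imset_f.
  by rewrite uA inE.
by exists (lshift n a); rewrite // porbit_perm_catl -Aa AT.
Qed.

(** A permutation preserving the first block also preserves its complement, hence restricts to a
    permutation of each block. *)
Lemma im_perm_catP w :
  reflect (exists uv, w = perm_cat uv) (w @: lshifts == lshifts).
Proof.
apply: (iffP eqP) => [wL|[[u v] ->]]; last first.
  apply/eqP; rewrite eqEcard (card_imset _ (@perm_inj _ _)) leqnn andbT.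
  apply/subsetP => _ /imsetP[_ /imsetP[a _ ->] ->].
  by rewrite perm_cat_lshift mem_lshifts.
have memw i : (w i \in lshifts) = (i \in lshifts).
  by rewrite -{1}wL (mem_imset _ _ (@perm_inj _ w)).
have hu a : {b | w (lshift n a) = lshift n b}.
  case: (split_ordP (w (lshift n a))) => b wb; first by exists b.
  by have := memw (lshift n a); rewrite wb mem_rshifts mem_lshifts.
have hv a : {b | w (rshift m a) = rshift m b}.
  case: (split_ordP (w (rshift m a))) => b wb; last by exists b.
  by have := memw (rshift m a); rewrite wb mem_rshifts mem_lshifts.
have u_inj : injective (fun a => sval (hu a)).
  move=> a a' E; apply: (@lshift_inj _ n); apply: (@perm_inj _ w).
  by rewrite (svalP (hu a)) (svalP (hu a')) E.
have v_inj : injective (fun a => sval (hv a)).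
  move=> a a' E; apply: (@rshift_inj m); apply: (@perm_inj _ w).
  by rewrite (svalP (hv a)) (svalP (hv a')) E.
exists (perm u_inj, perm v_inj); apply/permP => i.
case: (split_ordP i) => a ->; rewrite ?perm_cat_lshift ?perm_cat_rshift permE.
  exact: (svalP (hu a)).
exact: (svalP (hv a)).
Qed.

Let Km : {group 'S_(m + n)} := (perm_cat_morphism m n @* [set: 'S_m * 'S_n])%G.

Lemma mem_im_perm_cat w : (w \in Km) = (w @: lshifts == lshifts).
Proof.
apply/morphimP/im_perm_catP => [[uv _ _ ->]|[uv ->]]; first by exists uv.
by exists uv; rewrite ?inE.
Qed.

(** At most one pair contributes, as [perm_cat] is injective. If there is none, w does not stabilize
    the first block, which therefore cannot be one of its cycles. *)
Lemma sum_perm_cat_porbits w k :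
  (\sum_(uv : 'S_m * 'S_n | perm_cat uv == w)
     (#|porbits uv.1| == 1) * (#|porbits uv.2| == k) =
   (#|porbits w| == k.+1) && (lshifts \in porbits w))%N.
Proof.
have [/im_perm_catP[[u v] ->]|wL] := boolP (w @: lshifts == lshifts).
  rewrite (big_pred1 (u, v)) => [|uv] /=.
    rewrite lshifts_porbits card_porbits_perm_cat.
    by case: eqVneq => [->|_]; rewrite ?andbF // mul1n andbT add1n eqSS.
  by apply/eqP/eqP => [|-> //]; apply: (injmP (perm_cat_injm m n)); rewrite inE.
rewrite big1 => [|uv /eqP E]; last by case/im_perm_catP: wL; exists uv.
case: (boolP (lshifts \in _)) => [/imsetP[i _ E]|]; last by rewrite andbF.
by case/eqP: wL; rewrite E porbit_stable.
Qed.

(** Orbit-stabilizer: cosets of the stabilizer of the first block correspond to its translates,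
    which are all the m-subsets. *)
Lemma sum_rcosets_lshifts (F : {set 'I_(m + n)} -> nat) :
  (\sum_(C in rcosets Km [set: 'S_(m + n)]) F (repr C @: lshifts) =
   \sum_(A : {set 'I_(m + n)} | #|A| == m) F A)%N.
Proof.
pose phi (C : {set 'S_(m + n)}) := (repr C @: lshifts : {set 'I_(m + n)}).
have phi_inj : {in rcosets Km [set: 'S_(m + n)] &, injective phi}.
  have CE C : C \in rcosets Km [set: 'S_(m + n)] -> C = (Km :* repr C)%g.
    by case/rcosetsP=> x _ ->; apply/esym/rcoset_eqP/mem_repr_rcoset.
  move=> C D /CE C_E /CE D_E E; rewrite C_E D_E; apply/rcoset_eqP.
  move: E; rewrite /phi; move: (repr C) (repr D) => x' y' E.
  rewrite mem_rcoset mem_im_perm_cat.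
  by rewrite imset_permM E -imset_permM mulgV imset_perm1.
rewrite -(big_imset F phi_inj) /=; apply: eq_bigl => A.
suff -> : phi @: rcosets Km [set: 'S_(m + n)] = [set A : {set 'I_(m + n)} | #|A| == m].
  by rewrite inE.
apply/eqP; rewrite eqEcard; apply/andP; split.
  apply/subsetP => _ /imsetP[C _ ->].
  by rewrite inE (card_imset _ (@perm_inj _ _)) card_lshifts.
(* Surjectivity by counting: the index of the block subgroup, (m + n)! / (m! n!), is the number of
   m-subsets. *)
rewrite (card_in_imset phi_inj) card_draws card_ord.
have KmE : #|Km| = (m`! * n`!)%N.
  rewrite card_injm ?perm_cat_injm //.
  by rewrite cardsT card_prod !card_Sn.
rewrite -(leq_pmul2l (cardG_gt0 Km)) Lagrange ?subsetT // KmE.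
by rewrite cardsT card_Sn mulnC -{2}[n](addKn m) bin_fact // leq_addr.
Qed.

(** The coset attached to A contributes when A is a cycle of w and k other cycles remain: the left
    factor is the cycle singled out, the right factor carries the rest. *)
Lemma sum_rcosets_perm_cat w k :
  (\sum_(C in rcosets Km [set: 'S_(m + n)])
     \sum_(uv : 'S_m * 'S_n | perm_cat uv == (w ^ (repr C)^-1)%g)
       (#|porbits uv.1| == 1) * (#|porbits uv.2| == k) =
   (#|porbits w| == k.+1) *
     \sum_(A : {set 'I_(m + n)} | #|A| == m) (A \in porbits w))%N.
Proof.
rewrite -sum_rcosets_lshifts big_distrr /=; apply: eq_bigr => C _.
rewrite sum_perm_cat_porbits card_porbits_conj mulnb.
by rewrite -[in RHS](conjgKV (repr C) w) mem_porbits_conj conjgKV.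
Qed.

End PermCat.

(** This absorbs the sum over degrees in [hmul]: letting the length of the chosen cycle vary, every
    cycle is chosen once. *)
Lemma sum_porbits_by_card n (g : 'S_n) :
  (\sum_(i < n.+1) \sum_(A : {set 'I_n} | #|A| == i) (A \in porbits g) =
   #|porbits g|)%N.
Proof.
rewrite -sum1_card [RHS]big_mkcond.
rewrite [RHS](partition_big (fun A : {set 'I_n} => inord #|A| : 'I_n.+1) predT) //=.
apply: eq_bigr => i _; apply: eq_big => A; last by case: (_ \in _).
by rewrite -val_eqE /= inordK // ltnS -[n in (_ <= n)%N]card_ord max_card.
Qed.

(** * Cross-products of cycle classes *)

Lemma split_lshift m n (a : 'I_m) : split (lshift n a) = inl a.
Proof. exact: unsplitK (inl a). Qed.

Lemma split_rshift m n (a : 'I_n) : split (rshift m a) = inr a.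
Proof. exact: unsplitK (inr a). Qed.

Section CrossProducts.
Variables (k : closedFieldType) (R : comAlgType rat) (H : cross_theory k R).
Implicit Types (X Y Z : qpvar k).

Lemma qpiso_inv X Y (f : qpiso X Y) : exists g : qpiso Y X, cancel f g /\ cancel g f.
Proof.
have [rf [g [fK gK rg]]] := iso_prf f.
by exists (mk_iso gK fK rg rf).
Qed.

Lemma push_cancel X Y (f : qpiso X Y) (g : qpiso Y X) (a : H X) :
  cancel f g -> push H g (push H f a) = a.
Proof. by move=> fK; rewrite -push_comp -[RHS]push_id; apply: push_ext. Qed.

Lemma crossMnl X Y (a : H X) (b : H Y) n : cross H (a *+ n) b = cross H a b *+ n.
Proof. by elim: n => [|n IHn]; rewrite ?mulr0n ?cross0l // !mulrSr crossDl IHn. Qed.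

Lemma crossMnr X Y (a : H X) (b : H Y) n : cross H a (b *+ n) = cross H a b *+ n.
Proof. by elim: n => [|n IHn]; rewrite ?mulr0n ?cross0r // !mulrSr crossDr IHn. Qed.

(** Induction on m: the base case is the left unit law, the inductive step is associativity. *)
Lemma bigcross_cat Z m n (c : 'I_(m + n) -> H Z) :
  bigcross c = push H (iso_cat Z m n)
    (cross H (bigcross (fun a => c (lshift n a)))
             (bigcross (fun a => c (rshift m a)))).
Proof.
elim: m c => [|m IHm] c.
  rewrite /= -[X in cross _ _ X](@push_id _ _ H) cross_push -push_comp.
  rewrite -[LHS](@cross1l _ _ H).
  have -> : (fun a => c (rshift 0 a)) = c by apply/funext => a; congr c; apply: val_inj.
  apply: push_ext => -[[] z] /=; apply/funext => i.
  by case: split_ordP => [[]|j ->] //=; congr z; apply: val_inj.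
rewrite [LHS]bigcrossS [in RHS]bigcrossS (IHm (fun j => c (lift ord0 j))).
have -> : (fun a => c (lift ord0 (lshift n a))) = (fun a => c (lshift n (lift ord0 a))).
  by apply/funext => a; congr c; apply: val_inj.
have -> : (fun a => c (lift ord0 (rshift m a))) = (fun a => c (rshift m.+1 a)).
  by apply/funext => a; congr c; apply: val_inj.
have -> : c (lshift n ord0) = c ord0 by congr c; apply: val_inj.
set x := c _; set A := bigcross _; set B := bigcross _.
rewrite -[in LHS](@push_id _ _ H _ x) -[in RHS](@push_id _ _ H _ B).
rewrite !cross_push -crossA -!push_comp.
apply: push_ext => -[[z y] y'] /=; apply/funext => i; rewrite /insert_fun /=.
case: (split_ordP i) => a ->.
  case: (unliftP ord0 a) => [a'|] ->.
    have -> : lshift n (lift ord0 a') = lift ord0 (lshift n a') by apply: val_inj.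
    by rewrite liftK /= split_lshift.
  have -> : lshift n ord0 = ord0 :> 'I_(m + n).+1 by apply: val_inj.
  by rewrite unlift_none.
have -> : rshift m.+1 a = lift ord0 (rshift m a) by apply: val_inj.
by rewrite liftK /= split_rshift.
Qed.

Lemma bigcross1 Z : exists f : qpiso Z (powv Z 1), (forall z i, f z i = z) /\
  forall c, bigcross c = push H f (c ord0).
Proof.
have [g [gK Kg]] := qpiso_inv (iso_unitr Z).
exists (iso_comp (iso_insert Z ord0) (iso_comp (iso_prod (iso_id Z) (iso_pow0 Z)) g)).
split=> [z i|c].
  by rewrite /= /insert_fun (ord1 i) unlift_none /=; exact: (Kg z).
rewrite bigcrossS !push_comp -[c ord0 in RHS](@cross1r _ _ H).
by rewrite push_cancel // -cross_push push_id.
Qed.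

End CrossProducts.

(** * Cycle classes: independence of choices, conjugation and block sums *)

Section CycleClass.
Variables (k : closedFieldType) (R : comAlgType rat) (H : cross_theory k R).
Variables (Z : qpvar k) (b : nat -> H Z).

(* The choices in [cycle_class], an order on the cycles of s and representatives, *)
(* are immaterial: any numbering f of the cycles will do.                       *)
Lemma cycle_class_unique n (s : 'S_n) m (f : 'I_n -> 'I_m)
    (F : qpiso (powv Z m) (fixv (perm_act Z n) s)) (c : 'I_m -> H Z) :
  (forall i j, (f i == f j) = (porbit s i == porbit s j)) ->
  (forall a, exists i, f i = a) ->
  (forall y i, sval (F y) i = y (f i)) ->
  (forall i, c (f i) = b #|porbit s i|) ->
  push H F (bigcross c) = cycle_class b s.
Proof.
move=> f_eq f_surj FE cE.
have f_surj' a : exists i, f i == a by have [i <-] := f_surj a; exists i.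
pose r a := xchoose (f_surj' a).
have rK a : f (r a) = a by apply/eqP/(xchooseP (f_surj' a)).
pose t a := cycle_idx s (r a).
have tf i : t (f i) = cycle_idx s i by apply/eqP; rewrite cycle_idx_eq -f_eq rK.
have t_inj : injective t.
  by move=> a a' /eqP; rewrite cycle_idx_eq -f_eq !rK => /eqP.
have u_inj : injective (fun a => f (@cycle_repr n s a)).
  move=> a a' /eqP; rewrite f_eq -cycle_idx_eq !cycle_reprK; exact/eqP.
(* Injections in both directions identify m with the number of cycles; t then becomes a permutation,
   and [bigcross_reindex] applies. *)
have mE : m = size (cycles s).
  have := leq_card _ t_inj; have := leq_card _ u_inj.
  by rewrite !card_ord => ? ?; apply/eqP; rewrite eqn_leq; apply/andP.
clearbody t; clear u_inj r rK; subst m.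
have -> : bigcross c = push H (iso_reindex Z (perm t_inj))
    (bigcross (fun a => b #|nth set0 (cycles s) a|)).
  rewrite -bigcross_reindex; congr bigcross; apply/funext => a.
  have [i <-] := f_surj a.
  by rewrite permE tf nth_cycle_idx cE.
rewrite -push_comp; apply: push_ext => y /=.
have Fy := FE ((fun i => y (perm t_inj i)) : powv Z _).
move: (F _) Fy => [z zP] /= zE.
by apply: eq_exist; apply/funext => i; rewrite zE permE tf.
Qed.

(** Conjugation by h carries the cycles of s to those of s ^ h without changing lengths, so a
    numbering of the former, composed with the inverse of h, numbers the latter. *)
Lemma Hact_cycle_class n (s h : 'S_n) :
  Hact h (Hin (cycle_class b s)) = Hin (cycle_class b (s ^ h)%g).
Proof.
rewrite Hact_in; congr Hin; rewrite -push_comp.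
have hE i : porbit (s ^ h)%g i = h @: porbit s ((h^-1)%g i).
  by rewrite -porbit_conj permKV.
apply: (cycle_class_unique (f := fun i => cycle_idx s ((h^-1)%g i))).
- by move=> i j; rewrite cycle_idx_eq !hE (inj_eq (imset_inj (@perm_inj _ h))).
- by move=> a; exists (h (cycle_repr a)); rewrite permK cycle_reprK.
- by [].
- by move=> i; rewrite nth_cycle_idx hE card_imset //; apply: perm_inj.
Qed.

(** The cycles of a block sum are those of u followed by those of v, and [bigcross_cat] splits the
    iterated cross-product accordingly. *)
Lemma cycle_class_perm_cat m n (uv : 'S_m * 'S_n) :
  push H (iso_fixeq (@perm_cat_act _ Z m n) uv)
    (push H (iso_fixprod (perm_act Z m) (perm_act Z n) uv)
      (cross H (cycle_class b uv.1) (cycle_class b uv.2))) =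
  cycle_class b (perm_cat uv).
Proof.
case: uv => u v /=; rewrite {1 2}/cycle_class cross_push.
set p := size (cycles u); set q := size (cycles v).
pose c (a : 'I_(p + q)) := match split a with
  | inl a => b #|nth set0 (cycles u) a| | inr a => b #|nth set0 (cycles v) a| end.
have [g [catK gK]] := qpiso_inv (iso_cat Z p q).
have cE := bigcross_cat c.
have cl : (fun a => c (lshift q a)) = (fun a => b #|nth set0 (cycles u) a|).
  by apply/funext => a; rewrite /c split_lshift.
have cr : (fun a => c (rshift p a)) = (fun a => b #|nth set0 (cycles v) a|).
  by apply/funext => a; rewrite /c split_rshift.
rewrite cl cr in cE.
rewrite -(push_cancel (cross H _ _) catK) -cE -!push_comp.
(* The numbering required by [cycle_class_unique]: cycles of u get the first p numbers, cycles of v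
   the last q. *)
pose f (i : 'I_(m + n)) : 'I_(p + q) := match split i with
  | inl a => lshift q (cycle_idx u a) | inr a => rshift p (cycle_idx v a) end.
apply: (cycle_class_unique (f := f)).
- move=> i j; rewrite /f.
  case: (split_ordP i) => x ->; case: (split_ordP j) => y ->;
  rewrite ?porbit_perm_catl ?porbit_perm_catr.
  + by rewrite (inj_eq (@lshift_inj _ _)) cycle_idx_eq (inj_eq (imset_inj (@lshift_inj _ _))).
  + rewrite eq_lrshift; apply/esym/eqP => /setP/(_ (lshift n x)).
    rewrite imset_f ?porbit_id // => /esym/imsetP[z _ /eqP].
    by rewrite eq_lrshift.
  + rewrite eq_rlshift; apply/esym/eqP => /setP/(_ (lshift n y)).
    rewrite (imset_f _ (porbit_id _ _)) => /imsetP[z _ /eqP].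
    by rewrite eq_lrshift.
  + by rewrite (inj_eq (@rshift_inj _ _)) cycle_idx_eq (inj_eq (imset_inj (@rshift_inj _ _))).
- move=> a; case: (split_ordP a) => x ->.
    by exists (lshift n (cycle_repr x)); rewrite /f split_lshift cycle_reprK.
  by exists (rshift m (cycle_repr x)); rewrite /f split_rshift cycle_reprK.
- move=> y i; rewrite -[in RHS](gK y) /=.
  by rewrite /f; case: (split_ordP i) => x _; rewrite ?(split_lshift, split_rshift).
- move=> i; rewrite /f /c; case: (split_ordP i) => x ->;
  rewrite ?(split_lshift, split_rshift) nth_cycle_idx.
    by rewrite porbit_perm_catl card_imset //; apply: lshift_inj.
  by rewrite porbit_perm_catr card_imset //; apply: rshift_inj.
Qed.

End CycleClass.

(** * Multiplicities *)

(** Rational scalars enter here: it cancels both the 1/r of the creation operators and the 1/m! of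
    the exponential. *)
Lemma ratr_scaleMn (R : comAlgType rat) (V : lmodType R) (v : V) p q :
  (0 < p)%N -> ((p%:R^-1 : rat)%:A : R) *: (v *+ (p * q)) = v *+ q.
Proof.
move=> p0; rewrite mulnC mulrnA -scaler_nat scalerA -scalerAl mul1r.
have -> : (p%:R : R) = (p%:R : rat)%:A by rewrite scaler_nat.
by rewrite scalerA mulVf ?scale1r // pnatr_eq0 -lt0n.
Qed.

Section Multiplicities.
Variables (k : closedFieldType) (R : comAlgType rat) (H : cross_theory k R).
Variables (Z : qpvar k) (b : nat -> H Z).

(** A relation, since c is not determined by a where a cycle class vanishes; only the converse,
    [mult_eq], matters. *)
Definition has_mult n (a : Hfix H (perm_act Z n)) (c : 'S_n -> nat) : Prop :=
  forall g, a g = cycle_class b g *+ c g.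

Lemma dsumMnE n (a : Hfix H (perm_act Z n)) p g : (a *+ p) g = a g *+ p.
Proof. by elim: p => [|p IHp]; rewrite ?mulr0n ?dsum0E // !mulrSr dsumDE IHp. Qed.

Lemma mult_Hin n (I : finType) (f : I -> 'S_n) (p : I -> nat) :
  has_mult (\sum_i Hin (cycle_class b (f i)) *+ p i)
           (fun g => \sum_(i | f i == g) p i)%N.
Proof.
move=> g; rewrite dsum_sumE -sumrMnr [RHS]big_mkcond /=; apply: eq_bigr => i _.
rewrite dsumMnE; case: eqP => [<-|/eqP fg]; first by rewrite /Hin dsum_in_id.
by rewrite /Hin dsum_in_neq // mul0rn.
Qed.

Lemma mult_sum n (I : Type) (r : seq I) (P : pred I)
    (F : I -> Hfix H (perm_act Z n)) (c : I -> 'S_n -> nat) :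
  (forall i, P i -> has_mult (F i) (c i)) ->
  has_mult (\sum_(i <- r | P i) F i) (fun g => \sum_(i <- r | P i) c i g)%N.
Proof.
by move=> Fc g; rewrite dsum_sumE -sumrMnr; apply: eq_bigr => i Pi; apply: Fc.
Qed.

Lemma mult_HSym_sum n (I : Type) (r : seq I) (P : pred I)
    (F : I -> HSym H Z n) (c : I -> 'S_n -> nat) :
  (forall i, P i -> has_mult (HG_val (F i)) (c i)) ->
  has_mult (HG_val (\sum_(i <- r | P i) F i))
           (fun g => \sum_(i <- r | P i) c i g)%N.
Proof. by move=> Fc; rewrite linear_sum; apply: mult_sum. Qed.

Lemma mult_eq n (a a' : Hfix H (perm_act Z n)) c :
  has_mult a c -> has_mult a' c -> a = a'.
Proof. by move=> ac ac'; apply/ffunP => g; rewrite ac ac'. Qed.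

Lemma mult_ext n (a : Hfix H (perm_act Z n)) c c' :
  c =1 c' -> has_mult a c -> has_mult a c'.
Proof. by move=> cc' ac g; rewrite ac cc'. Qed.

Lemma mult_decomp n (a : Hfix H (perm_act Z n)) c :
  has_mult a c -> a = \sum_g Hin (cycle_class b g) *+ c g.
Proof.
move=> ac; rewrite [LHS]dsum_decomp; apply: eq_bigr => g _.
by rewrite ac linearMn.
Qed.

Lemma mult_Hact n (a : Hfix H (perm_act Z n)) c h :
  has_mult a c -> has_mult (Hact h a) (fun g => c (g ^ h^-1)%g).
Proof.
move=> /mult_decomp ->; rewrite linear_sum /=.
under eq_bigr do rewrite linearMn /= Hact_cycle_class.
apply: mult_ext (mult_Hin _ _) => g.
by rewrite (big_pred1 (g ^ h^-1)%g) // => x; rewrite -(inj_eq (conjg_inj (h^-1)%g)) conjgK.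
Qed.

Lemma mult_Ind n (K : {group 'S_n}) (a : HG H (perm_act Z n) K) c :
  has_mult (HG_val a) c ->
  has_mult (HG_val (Ind a))
    (fun g => \sum_(C in rcosets K [set: 'S_n]) c (g ^ (repr C)^-1)%g)%N.
Proof. by move=> ac; apply: mult_sum => C _; apply: mult_Hact. Qed.

Lemma mult_odot m n (x : HSym H Z m) (y : HSym H Z n) c d :
  has_mult (HG_val x) c -> has_mult (HG_val y) d ->
  has_mult (HG_val (odot x y))
    (fun g => \sum_(C in rcosets (perm_cat_morphism m n @* [set: 'S_m * 'S_n])
                                 [set: 'S_(m + n)])
       \sum_(uv | perm_cat uv == (g ^ (repr C)^-1)%g) c uv.1 * d uv.2)%N.
Proof.
move=> xc yd; apply: (mult_Ind (c := fun g => \sum_(uv | perm_cat uv == g) c uv.1 * d uv.2)%N).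
rewrite /=.
under eq_bigr => uv _.
  rewrite ffunE xc yd crossMnl crossMnr !linearMn -mulrnA /=.
  rewrite cycle_class_perm_cat mulnC.
  over.
exact: mult_Hin.
Qed.

(** Common to [bsigma], with p = 1, and to [creation], where the cyclic group is the centralizer and
    p is the length of the cycle. *)
Lemma mult_Ind_cent n (K : {group 'S_n}) (a : HG H (perm_act Z n) K) s p :
  K :=: 'C[s]%g -> HG_val a = Hin (cycle_class b s) *+ p ->
  has_mult (HG_val (Ind a)) (fun g => (g \in s ^: [set: 'S_n])%g * p)%N.
Proof.
move=> KE aE; apply: mult_ext (mult_Ind (c := fun g => (g == s) * p)%N _) => [g|g].
  exact: sum_rcosets_cent1.
rewrite aE dsumMnE; case: eqP => [->|/eqP gs]; first by rewrite /Hin dsum_in_id mul1n.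
by rewrite /Hin dsum_in_neq 1?eq_sym // mul0rn.
Qed.

Lemma mult_bsigma n (s : 'S_n) :
  has_mult (HG_val (bsigma b s)) (fun g => g \in s ^: [set: 'S_n])%g.
Proof.
apply: mult_ext (mult_Ind_cent (p := 1) (s := s) _ _) => [g||] //.
by rewrite muln1.
Qed.

(** With a single cycle, the iterated cross-product has one factor and the numbering is constant. *)
Lemma cycle_class_rcycle r :
  push H (iso_diag Z r) (b r.+1) = cycle_class b (rcycle r.+1).
Proof.
have [G [GE G_b]] := bigcross1 H Z.
have [G' [GK G'K]] := qpiso_inv G.
rewrite -(push_cancel (b r.+1) GK) -(G_b (fun=> b r.+1)) -push_comp.
apply: (cycle_class_unique (f := fun=> ord0)).
- by move=> i j; rewrite !porbit_rcycle !eqxx.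
- by move=> a; exists ord0; rewrite (ord1 a).
- by move=> y i /=; rewrite -[in RHS](G'K y) GE.
- by move=> i; rewrite porbit_rcycle cardsT card_ord.
Qed.

Lemma mult_creation r :
  has_mult (HG_val (((r.+1%:R^-1 : rat)%:A : R) *: creation r (b r.+1)))
           (fun g => #|porbits g| == 1)%N.
Proof.
have aE : push H (iso_diag Z r) (b r.+1 *+ r.+1) =
    cycle_class b (rcycle r.+1) *+ r.+1 by rewrite linearMn /= cycle_class_rcycle.
have K_E : <[rcycle r.+1]>%G :=: 'C[rcycle r.+1]%g by rewrite cent1_rcycle.
have := mult_Ind_cent (a := HG_in _ (@creation_subproof _ _ H Z r (b r.+1 *+ r.+1)))
  (p := r.+1) K_E.
rewrite -/(creation r (b r.+1)) => cE g.
rewrite linearZ dsumZE cE; last by rewrite /HG_in /= aE linearMn.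
by rewrite one_porbit_rcycle mulnC ratr_scaleMn.
Qed.

Lemma mult_HSym_one : has_mult (HG_val (HSym_one H Z)) (fun=> 1%N).
Proof.
move=> g; have {g}-> : g = 1%g by apply/permP => -[].
rewrite /= /Hin dsum_in_id mulr1n -[push H (iso_pow0 Z) _]/(bigcross (@ord0_rect (H Z))).
by apply: (cycle_class_unique (f := fun i => i)) => [i|i|y i|i] //; case: i.
Qed.

(** Taking c as a family over all degrees avoids transporting multiplicities along e. *)
Lemma mult_cast m n (e : m = n) (a : HSym H Z m) (c : forall n, 'S_n -> nat) :
  has_mult (HG_val a) (c m) -> has_mult (HG_val (HSym_cast e a)) (c n).
Proof. by case: _ / e. Qed.

(** An ordering of m + 1 cycles is a choice of the first one, B, and an ordering of the m others;
    the index i in [hmul] is the size of B. *)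
Lemma mult_hpow (A : hseries H Z) m n :
  (forall n, has_mult (HG_val (A n)) (fun g => #|porbits g| == 1)%N) ->
  has_mult (HG_val (hpow A m n)) (fun g => m`! * (#|porbits g| == m))%N.
Proof.
move=> A1; elim: m n => [|m IHm] n.
  case: n => [|n].
    apply: mult_ext mult_HSym_one => g.
    by have := card_porbits_le g; rewrite card_ord leqn0 => ->.
  move=> g; rewrite -[hpow _ _ _]/(0 : HSym H Z n.+1) linear0 dsum0E.
  (* The unit vanishes in positive degree, where every permutation has at least one cycle. *)
  suff -> : (#|porbits g| == 0)%N = false by rewrite muln0 mulr0n.
  by apply: negbTE; rewrite -lt0n card_gt0; apply/set0Pn; exists (porbit g ord0); apply: imset_f.
rewrite /hpow iterS -/(hpow A m) /hmul.
pose c (i p : nat) (g : 'S_p) := (m`! * ((#|porbits g| == m.+1) *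
  \sum_(B : {set 'I_p} | #|B| == i) (B \in porbits g)))%N.
apply: mult_ext (mult_HSym_sum _ (c := fun i : 'I_n.+1 => c i n) _) => [g|i _].
  rewrite /c -!big_distrr /= sum_porbits_by_card factS -mulnA mulnCA.
  by case: eqVneq => [->|_]; rewrite ?muln0 // mul1n muln1 mulnC.
apply: (mult_cast _ (c := c i)); apply: mult_ext (mult_odot (A1 i) (IHm _)) => g.
rewrite /c -sum_rcosets_perm_cat big_distrr /=; apply: eq_bigr => C _.
by rewrite big_distrr /=; apply: eq_bigr => uv _; rewrite mulnCA.
Qed.

Lemma mult_hexp (A : hseries H Z) n :
  (forall n, has_mult (HG_val (A n)) (fun g => #|porbits g| == 1)%N) ->
  has_mult (HG_val (hexp A n)) (fun=> 1%N).
Proof.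
move=> A1 g; rewrite /hexp linear_sum dsum_sumE.
under eq_bigr => m _.
  rewrite linearZ dsumZE (mult_hpow m A1) ratr_scaleMn ?fact_gt0 //.
  over.
rewrite sumrMnr; congr (_ *+ _).
(* A permutation of n points has at most n cycles, so the truncated sum contains the only surviving
   term, the one with m equal to the number of cycles of g. *)
have gn : (#|porbits g| < n.+1)%N by rewrite ltnS -[n in (_ <= n)%N]card_ord card_porbits_le.
rewrite (bigD1 (Ordinal gn)) //= eqxx big1 // => m.
by rewrite -val_eqE /= eq_sym => /negbTE ->.
Qed.

(** The conjugacy classes partition the group, so each g is met once. *)
Lemma mult_sum_bsigma n :
  has_mult (HG_val (\sum_(C in classes [set: 'S_n]) bsigma b (repr C))) (fun=> 1%N).
Proof.
apply: mult_ext (mult_HSym_sum _ _) => [g|C _]; last exact: mult_bsigma.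
have g_cl : (g ^: [set: 'S_n] \in classes [set: 'S_n])%g by rewrite mem_classes ?inE.
have memE C : C \in classes [set: 'S_n] ->
    (g \in repr C ^: [set: 'S_n])%g = (C == g ^: [set: 'S_n])%g.
  move=> /repr_classesP[_ {2}->].
  by apply/idP/eqP => [/class_eqP|->]; rewrite ?class_refl.
rewrite (eq_bigr _ (fun C hC => congr1 nat_of_bool (memE C hC))).
by rewrite (bigD1 _ g_cl) /= eqxx big1 // => C /andP[_ /negbTE ->].
Qed.

End Multiplicities.

(** * Comparison of the two series degree by degree *)

Theorem theorem3p1 (K : realType) (R : comAlgType rat)
    (H : cross_theory K[i] R) (Z : qpvar K[i]) (b : nat -> H Z) :
  (fun n => \sum_(C in classes [set: 'S_n]) bsigma b (repr C)) =
  hexp (fun n => match n return HSym H Z n with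
                 | 0 => 0
                 | r.+1 => ((r.+1%:R^-1 : rat)%:A : R) *: creation r (b r.+1)
                 end)
  :> hseries H Z.
Proof.
apply: functional_extensionality_dep => n; apply: val_inj.
apply: (mult_eq (mult_sum_bsigma b (n := n))); apply: mult_hexp => -[|r].
  (* In degree 0 the series is 0, in agreement with the empty permutation having no cycle rather
     than one. *)
  move=> g; rewrite linear0 dsum0E.
  by have := card_porbits_le g; rewrite card_ord leqn0 => /eqP ->.
exact: mult_creation.
Qed.
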